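(* Let $p\ge 0$, $\lambda>0$, $\gamma,\vartheta,\upsilon\in\mathbb{C}$ and $|t|<1$. Then $$\sum_{n=0}^\infty(\gamma)_n\,\Phi_{\gamma+n,\vartheta;\upsilon}(z,\sigma,a;p,\lambda)\,\frac{t^n}{n!}=(1-t)^{-\gamma}\,\Phi_{\gamma,\vartheta;\upsilon}\Big(\frac{z}{1-t},\sigma,a;p,\lambda\Big),$$ where $\Phi_{\gamma,\vartheta;\upsilon}(z,\sigma,a;p,\lambda)$ is the extended Hurwitz-Lerch Zeta function.
   Context: $(\gamma)_n=\gamma(\gamma+1)\cdots(\gamma+n-1)$, $(\gamma)_0=1$, is the Pochhammer symbol; $B(x,y)$ is the classical beta function. The Mittag-Leffler function is $E_\lambda(w)=\sum_{n=0}^\infty \frac{w^n}{\Gamma(\lambda n+1)}$. For $\Re(x)>0$, $\Re(y)>0$ the extended beta function is $$B(x,y;p,\lambda)=\int_0^1 u^{x-1}(1-u)^{y-1}E_\lambda\Big(-\frac{p}{u(1-u)}\Big)du.$$ The extended Hurwitz-Lerch Zeta function is $$\Phi_{\gamma,\vartheta;\upsilon}(z,\sigma,a;p,\lambda)=\sum_{k=0}^\infty\frac{(\gamma)_k\,B(\vartheta+k,\upsilon-\vartheta;p,\lambda)}{B(\vartheta,\upsilon-\vartheta)\,k!}\frac{z^k}{(k+a)^\sigma},$$ for $p\ge0$, $\lambda>0$, $\gamma,\vartheta,\upsilon\in\mathbb{C}$, $a\in\mathbb{C}\setminus\{0,-1,-2,\dots\}$, with $\sigma\in\mathbb{C}$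 when $|z|<1$ and $\Re(\sigma+\upsilon-\gamma-\vartheta)>1$ when $|z|=1$.
   Formalization: For |t|<1 alone the left series can diverge. Proved: convergence and equality if |z|+|t|<1; otherwise equality whenever the left series converges and z/(1-t) is in the domain of Φ (with its series assumed convergent if |z/(1-t)|=1). All Φ_{γ+n} are taken at z in their domain. *)

(* Defs.v *)
From HB Require Import structures.
From mathcomp Require Import all_boot all_order all_algebra.
From mathcomp Require Import complex.
From mathcomp Require Import all_classical all_reals all_analysis.
Set Implicit Arguments.
Unset Strict Implicit.
Unset Printing Implicit Defensive.
Import Order.TTheory GRing.Theory Num.Theory.
Import numFieldNormedType.Exports.
Local Open Scope classical_set_scope.
Local Open Scope ring_scope.
Local Open Scope complex_scope.

(* The topology on the complex numbers is the one of the numField R[i] seen as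
   a normed module over itself, which the library attaches to the type R[i]^o;
   the norm `|z| takes its (real) values in R[i]. *)

Section ComplexFunctions.
Variable R : realType.
Implicit Types z w : R[i].

Definition Cexp z : R[i] :=
  (expR (complex.Re z))%:C * (cos (complex.Im z) +i* sin (complex.Im z)).

(* Principal argument, with values in ]-pi, pi] for z != 0. *)
Definition Carg z : R :=
  let th := acos (complex.Re z / Normc.normc z) in
  if 0 <= complex.Im z then th else - th.

Definition Clog z : R[i] := ln (Normc.normc z) +i* Carg z.

(* Principal branch of z ^ w; only meaningful for z != 0. *)
Definition Cpow z w : R[i] := Cexp (w * Clog z).

Definition poch (g : R[i]) (n : nat) : R[i] := \prod_(i < n) (g + i%:R).

(* Lebesgue integral of a complex-valued function, taken componentwise; a
   component that is not integrable contributes 0. *)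
Definition Cintegral (D : set R) (f : R -> R[i]) : R[i] :=
  (\int[lebesgue_measure]_(u in D) complex.Re (f u)) +i*
  (\int[lebesgue_measure]_(u in D) complex.Im (f u)).

End ComplexFunctions.

Section SpecialFunctions.
Variable R : realType.

Definition Gamma (s : R) : R :=
  \int[lebesgue_measure]_(x in `]0, +oo[) (x `^ (s - 1) * expR (- x)).

(* Only real arguments of E_lambda occur in the extended beta function. *)
Definition MittagLeffler (lam w : R) : R :=
  limn (series (fun n : nat => w ^+ n / Gamma (lam * n%:R + 1))).

Definition Beta (x y : R[i]) : R[i] :=
  Cintegral `]0, 1[ (fun u => Cpow u%:C (x - 1) * Cpow (1 - u)%:C (y - 1)).

Definition extBeta (x y : R[i]) (p lam : R) : R[i] :=
  Cintegral `]0, 1[ (fun u => Cpow u%:C (x - 1) * Cpow (1 - u)%:C (y - 1) *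
                              (MittagLeffler lam (- (p / (u * (1 - u)))))%:C).

Definition HLZ_term (g th up z sg a : R[i]) (p lam : R) (k : nat) : R[i]^o :=
  poch g k * extBeta (th + k%:R) (up - th) p lam / (Beta th (up - th) * k`!%:R)
  * (z ^+ k / Cpow (k%:R + a) sg).

(* Extended Hurwitz-Lerch zeta function
   Phi_{gamma, vartheta; upsilon}(z, sigma, a; p, lambda). *)
Definition HLZ (g th up z sg a : R[i]) (p lam : R) : R[i] :=
  limn (series (HLZ_term g th up z sg a p lam)).

Definition HLZ_dom (g th up z sg : R[i]) : Prop :=
  `|z| < 1 \/ (`|z| = 1 /\ 1 < complex.Re (sg + up - g - th)).

Definition genHLZ_term (g th up z sg a : R[i]) (p lam : R) (t : R[i]) (n : nat)
    : R[i]^o :=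
  poch g n * HLZ (g + n%:R) th up z sg a p lam * (t ^+ n / n`!%:R).

End SpecialFunctions.

(* Main.v *)
(* Write Phi_g(z) = sum_k (g)_k / k! d_k z^k. The extended beta functions
   B(th + k, up - th; p, lam) are integrals of u^k f(u) over ]0, 1[, hence bounded
   in k, and |k + a|^(- Re sg) grows polynomially; so d_k is subexponential and
   the growth of d is all that matters. If |z| + |t| < 1 the double series in
   (n, k) converges absolutely, and (g)_n (g + n)_k = (g)_k (g + k)_n together
   with the binomial series of (1 - t)^(- g - k) gives the identity.

   In general let F(t) = (1 - t)^(- g) Phi_g(z / (1 - t)) and let G be the power
   series in t on the left. The hypothesis for all n forces |z| < 1. F is analytic
   where |t| < 1 and |z| < |1 - t|, G is analytic inside its disc of convergence,
   and F = G near 0. The two are identified along segments inside the common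
   domain: 0 -> x t (x < 1) if Re t <= 0, and 0 -> i Im t -> t - e if Re t > 0.
   Abel's theorem then gives the value at t: the approach is radial in the first
   case (and F is continuous at t), and in the second t - e is a nontangential
   approach to t for G and corresponds to a nontangential approach to z / (1 - t)
   for Phi_g. *)

Require Import Defs.
From HB Require Import structures.
From mathcomp Require Import all_boot all_order all_algebra.
From mathcomp Require Import complex.
From mathcomp Require Import all_classical all_reals all_analysis.
From mathcomp Require Import ring lra.
Import Order.TTheory GRing.Theory Num.Theory.
Import numFieldNormedType.Exports.
Local Open Scope classical_set_scope.
Local Open Scope ring_scope.
Local Open Scope complex_scope.

Set Implicit Arguments.
Unset Strict Implicit.

Local Notation nc := Normc.normc.

(** * Complex series *)

Section ComplexNorm.
Variable R : realType.
Implicit Types (x y z w : R[i]) (e : R).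

Lemma normcC z : `|z| = (nc z)%:C.
Proof. by rewrite normc_def; case: z. Qed.

Lemma normc_ge0 z : 0 <= nc z.
Proof. by rewrite -ler0c -normcC. Qed.

Lemma normc_eq0 z : (nc z == 0) = (z == 0).
Proof.
by apply/eqP/eqP => [/Normc.eq0_normc//|->]; rewrite Normc.normc0.
Qed.

Lemma normc_gt0 z : (0 < nc z) = (z != 0).
Proof. by rewrite lt_def normc_eq0 normc_ge0 andbT. Qed.

Lemma normcD z w : nc (z + w) <= nc z + nc w.
Proof. exact: le_normcD. Qed.

Lemma normc_opp z : nc (- z) = nc z.
Proof. exact: normcN. Qed.

Lemma normcB z w : nc (z - w) <= nc z + nc w.
Proof. by rewrite -(normc_opp w) normcD. Qed.

Lemma normc_distC z w : nc (z - w) = nc (w - z).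
Proof. by rewrite -normc_opp opprB. Qed.

Lemma normc_triangle z w x : nc (z - x) <= nc (z - w) + nc (w - x).
Proof. by apply: le_trans (normcD _ _); rewrite addrA subrK. Qed.

Lemma normcX z n : nc (z ^+ n) = nc z ^+ n.
Proof.
by elim: n => [|n IH]; rewrite ?expr0 ?Normc.normc1// !exprS Normc.normcM IH.
Qed.

Lemma normc_real (r : R) : nc r%:C = `|r|.
Proof. by rewrite /= expr0n/= addr0 sqrtr_sqr. Qed.

Lemma normc_nat n : nc (n%:R : R[i]) = n%:R.
Proof. by rewrite -(rmorph_nat (real_complex R)) normc_real ger0_norm. Qed.

Lemma normc_sum (I : Type) (r : seq I) (P : pred I) (F : I -> R[i]) :
  nc (\sum_(i <- r | P i) F i) <= \sum_(i <- r | P i) nc (F i).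
Proof.
elim/big_rec2 : _ => [|i y1 y2 _ h]; first by rewrite Normc.normc0.
by apply: le_trans (normcD _ _) _; rewrite lerD2l.
Qed.

Lemma normc_sqr z : nc z ^+ 2 = complex.Re z ^+ 2 + complex.Im z ^+ 2.
Proof. by case: z => a b /=; rewrite sqr_sqrtr// addr_ge0// sqr_ge0. Qed.

Lemma normc_lt_sqr (x y : R[i]) : complex.Re x ^+ 2 + complex.Im x ^+ 2 <
  complex.Re y ^+ 2 + complex.Im y ^+ 2 -> nc x < nc y.
Proof.
by rewrite -!normc_sqr ltr_pXn2r ?nnegrE ?normc_ge0.
Qed.

Lemma ler_Re_normc z : `|complex.Re z| <= nc z.
Proof.
rewrite -(ler_pXn2r (ltn0Sn 1)) ?nnegrE ?normc_ge0//.
by rewrite normc_sqr real_normK ?num_real// lerDl sqr_ge0.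
Qed.

Lemma Re_le_normc z : complex.Re z <= nc z.
Proof. exact: le_trans (ler_norm _) (ler_Re_normc z). Qed.

Lemma ler_Im_normc z : `|complex.Im z| <= nc z.
Proof.
rewrite -(ler_pXn2r (ltn0Sn 1)) ?nnegrE ?normc_ge0//.
by rewrite normc_sqr real_normK ?num_real// lerDr sqr_ge0.
Qed.

Lemma normc_le_ReIm z : nc z <= `|complex.Re z| + `|complex.Im z|.
Proof.
rewrite -(ler_pXn2r (ltn0Sn 1)) ?nnegrE ?addr_ge0 ?normc_ge0//.
rewrite normc_sqr sqrrD !real_normK ?num_real//.
by rewrite -subr_ge0 [X in 0 <= X](_ : _ = `|complex.Re z| * `|complex.Im z| *+ 2) ?mulrn_wge0 ?mulr_ge0//; ring.
Qed.

End ComplexNorm.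

(** * Convergence of complex series, dominated convergence, exchange of sums *)

Section ComplexSeries.
Variable R : realType.
Implicit Types (a b : nat -> R[i]) (l m : R[i]) (e : R).

Definition csum a l := series (a : nat -> R[i]^o) @ \oo --> (l : R[i]^o).

(** Replaces the filter statement, whose radii are positive elements of [R[i]], by one with real
    radii, the form in which limits are handled below. *)
Lemma csumP a l : csum a l <-> forall e : R, 0 < e ->
  exists M, forall n, (M <= n)%N -> nc (\sum_(i < n) a i - l) < e.
Proof.
split.
  move=> /cvgrPdist_lt h e e0.
  have e0' : 0 < e%:C by rewrite ltcR.
  have [M _ HM] := h _ e0'; exists M => n Mn.
  have := HM n Mn; rewrite /= normcC ltcR normc_distC /series /=.
  by rewrite big_mkord.
move=> h; apply/cvgrPdist_lt => e e0.
have [er ei] : 0 < complex.Re e /\ complex.Im e = 0.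
  by move: e0; rewrite ltcE /= => /andP[/eqP -> ->].
have [M HM] := h _ er; exists M => // n /= Mn.
have := HM n Mn; rewrite /series /= big_mkord -ltcR normc_distC -normcC.
by congr (_ < _); case: {h e0 er HM} e ei => x y /= ->.
Qed.

Lemma csum_uniq a l m : csum a l -> csum a m -> l = m.
Proof. by move=> h1 h2; apply: (cvg_unique _ h1 h2); exact: norm_hausdorff. Qed.

Lemma csum_lim a l : csum a l -> limn (series (a : nat -> R[i]^o)) = l.
Proof. by move=> /cvg_lim -> //; exact: norm_hausdorff. Qed.

Lemma csum_bound a l (B : R) :
  csum a l -> (forall n, nc (\sum_(i < n) a i) <= B) -> nc l <= B.
Proof.
move=> /csumP al hB; apply/ler_addgt0Pr => e e0.
have [M /(_ M (leqnn M)) HM] := al e e0.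
have := normc_triangle l (\sum_(i < M) a i) 0.
rewrite !subr0 normc_distC => /le_trans; apply.
by rewrite addrC lerD// ltW.
Qed.

Lemma csumD a b l m : csum a l -> csum b m -> csum (fun n => a n + b n) (l + m).
Proof.
move=> /csumP al /csumP bm; apply/csumP => e e0.
have e2 : 0 < e / 2 by rewrite divr_gt0.
have [M1 H1] := al _ e2; have [M2 H2] := bm _ e2.
exists (maxn M1 M2) => n; rewrite geq_max => /andP[n1 n2].
rewrite big_split opprD addrACA; apply: le_lt_trans (normcD _ _) _.
by rewrite [e]splitr ltrD ?H1 ?H2.
Qed.

Lemma csumZ c a l : csum a l -> csum (fun n => c * a n) (c * l).
Proof.
move=> /csumP al; apply/csumP => e e0.
have c0 : 0 < nc c + 1 by rewrite ltr_wpDl ?normc_ge0.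
have [M HM] := al _ (divr_gt0 e0 c0); exists M => n Mn.
rewrite -mulr_sumr -mulrBr Normc.normcM.
have /ltW := HM n Mn => h; apply: le_lt_trans (ler_wpM2l (normc_ge0 _) h) _.
by rewrite mulrCA -[ltRHS]mulr1 ltr_pM2l// ltr_pdivrMr// mul1r ltrDl.
Qed.

Lemma csumB a b l m : csum a l -> csum b m -> csum (fun n => a n - b n) (l - m).
Proof.
move=> al /(csumZ (c := -1)) bm; rewrite -mulN1r.
by rewrite (_ : (fun n => _) = fun n => a n + -1 * b n);
  [exact: csumD|apply/funext => n; rewrite mulN1r].
Qed.

Lemma eq_csum a b l : a =1 b -> csum a l -> csum b l.
Proof. by move=> /funext ->. Qed.

Lemma csum0 : csum (fun=> 0) (0 : R[i]).
Proof.
by apply/csumP => e e0; exists 0%N => n _; rewrite big1// subrr Normc.normc0.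
Qed.

Lemma csum_sum (F : nat -> nat -> R[i]) (L : nat -> R[i]) :
  (forall k, csum (F k) (L k)) ->
  forall K, csum (fun n => \sum_(k < K) F k n) (\sum_(k < K) L k).
Proof.
move=> h; elim=> [|K IH].
  by rewrite big_ord0; apply: eq_csum csum0 => n; rewrite big_ord0.
by rewrite big_ord_recr; apply: eq_csum (csumD IH (h K)) => n; rewrite big_ord_recr.
Qed.

Lemma csum_recl a l : csum a l -> csum (fun n => a n.+1) (l - a 0%N).
Proof.
move=> /csumP al; apply/csumP => e e0; have [M HM] := al e e0.
exists M => n Mn; have := HM n.+1 (leqW Mn).
rewrite big_ord_recl; congr (nc _ < _).
by rewrite opprB addrA (addrC (a _)).
Qed.

Lemma real_abs_summable (u : nat -> R) (B : R) :
  (forall n, \sum_(i < n) `|u i| <= B) -> cvgn (series u).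
Proof.
move=> uB; apply: normed_cvg; apply: nondecreasing_is_cvgn.
  by apply: (nondecreasing_series (P := xpredT)) => n _ _; exact: normr_ge0.
by exists B => _ [n _ <-]; move: (uB n); rewrite -(big_mkord xpredT (fun i => `|u i|)).
Qed.

Lemma abs_csum a (B : R) :
  (forall n, \sum_(i < n) nc (a i) <= B) -> exists l, csum a l.
Proof.
move=> aB.
have hR : cvgn (series (fun n => complex.Re (a n))).
  apply: (@real_abs_summable _ B) => n; apply: le_trans (aB n).
  by apply: ler_sum => i _; exact: ler_Re_normc.
have hI : cvgn (series (fun n => complex.Im (a n))).
  apply: (@real_abs_summable _ B) => n; apply: le_trans (aB n).
  by apply: ler_sum => i _; exact: ler_Im_normc.
exists (limn (series (fun n => complex.Re (a n))) +i*
        limn (series (fun n => complex.Im (a n)))).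
apply/csumP => e e0; have e2 : 0 < e / 2 by rewrite divr_gt0.
have [M1 _ H1] := ((proj1 (cvgrPdist_lt _ _)) hR) _ e2.
have [M2 _ H2] := ((proj1 (cvgrPdist_lt _ _)) hI) _ e2.
exists (maxn M1 M2) => n; rewrite geq_max => /andP[n1 n2].
apply: le_lt_trans (normc_le_ReIm _) _; rewrite [e]splitr.
have sumE : \sum_(i < n) a i = (\sum_(i < n) complex.Re (a i)) +i*
                               (\sum_(i < n) complex.Im (a i)).
  elim: n {n1 n2} => [|n IH]; first by rewrite !big_ord0.
  by rewrite !big_ord_recr /= IH; case: (a n).
rewrite sumE /=; apply: ltrD.
  by have := H1 n n1; rewrite /= distrC /series /= big_mkord.
by have := H2 n n2; rewrite /= distrC /series /= big_mkord.
Qed.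

Lemma tail_small (r : nat -> R) (B e : R) : 0 < e -> (forall n, 0 <= r n) ->
  (forall n, \sum_(i < n) r i <= B) ->
  exists M, forall n, (M <= n)%N -> \sum_(i < n) r i - \sum_(i < M) r i < e.
Proof.
move=> e0 r0 rB.
have rs : cvgn (series r).
  apply: (@real_abs_summable _ B) => n; apply: le_trans (rB n).
  by apply: ler_sum => i _; rewrite ger0_norm.
have e2 : 0 < e / 2 by rewrite divr_gt0.
have [M _ HM] := ((proj1 (cvgrPdist_lt _ _)) rs) _ e2; exists M => n Mn.
have := HM n Mn; have := HM M (leqnn M); rewrite /= /series /= !big_mkord.
by rewrite !ltr_norml => /andP[? ?] /andP[? ?]; lra.
Qed.

Lemma sum_le_sub (a : nat -> R[i]) (r : nat -> R) (m n : nat) : (m <= n)%N ->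
  (forall i, nc (a i) <= r i) ->
  nc (\sum_(i < n) a i - \sum_(i < m) a i) <=
  \sum_(i < n) r i - \sum_(i < m) r i.
Proof.
move=> mn ar; rewrite -!(big_mkord xpredT) /=.
rewrite (big_cat_nat (n := m)) ?leq0n//= (big_cat_nat (n := m) (F := r)) ?leq0n//=.
rewrite !(addrC (\sum_(0 <= i < m) _)) !addrK.
by apply: le_trans (normc_sum _ _ _) _; apply: ler_sum.
Qed.

Lemma fin_sum_close (f : nat -> nat -> R[i]) (g : nat -> R[i]) (m : nat) :
  (forall n (e : R), 0 < e -> exists M, forall K, (M <= K)%N -> nc (f K n - g n) < e) ->
  forall e : R, 0 < e -> exists M, forall K, (M <= K)%N ->
    nc (\sum_(i < m) f K i - \sum_(i < m) g i) < e.
Proof.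
move=> fg; elim: m => [|m IH] e e0.
  by exists 0%N => K _; rewrite !big_ord0 subrr Normc.normc0.
have e2 : 0 < e / 2 by rewrite divr_gt0.
have [P HP] := IH _ e2; have [Q HQ] := fg m _ e2; exists (maxn P Q) => K.
rewrite geq_max => /andP[PK QK]; rewrite !big_ord_recr /= opprD addrACA.
apply: le_lt_trans (normcD _ _) _; have := HP K PK; have := HQ K QK.
by lra.
Qed.

(** Dominated convergence for series: beyond a rank M fixed by the tail of [r], the terms of [f K]
    and [g] are uniformly negligible, and below M there is only a finite sum. *)
Lemma tannery (f : nat -> nat -> R[i]) (g : nat -> R[i]) (S : nat -> R[i])
    (r : nat -> R) (B : R) :
  (forall n (e : R), 0 < e -> exists M, forall K, (M <= K)%N -> nc (f K n - g n) < e) ->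
  (forall K n, nc (f K n) <= r n) -> (forall n, \sum_(i < n) r i <= B) ->
  (forall K, csum (f K) (S K)) ->
  exists2 l, csum g l &
    forall e : R, 0 < e -> exists M, forall K, (M <= K)%N -> nc (S K - l) < e.
Proof.
move=> fg fr rB fS.
have r0 n : 0 <= r n by apply: le_trans (fr 0%N n); exact: normc_ge0.
have gr n : nc (g n) <= r n.
  apply/ler_addgt0Pr => e e0; have [M /(_ M (leqnn _)) HM] := fg n e e0.
  have := normc_triangle (g n) (f M n) 0; rewrite !subr0 normc_distC => /le_trans; apply.
  by rewrite addrC lerD// ltW.
have [l gl] : exists l, csum g l.
  by apply: (abs_csum (B := B)) => n; apply: le_trans (rB n); exact: ler_sum.
(* One fifth for each of: the series [f K] and [g] cut at n, their blocks between M and n, and the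
   difference of the first M terms. *)
exists l => // e e0; have e4 : 0 < e / 5 by rewrite divr_gt0.
have [M HM] := tail_small e4 r0 rB.
have [P HP] := fin_sum_close M fg e4.
exists (maxn M P) => K; rewrite geq_max => /andP[MK PK].
have /csumP/(_ _ e4)[M1 H1] := fS K.
have /csumP/(_ _ e4)[M2 H2] := gl.
pose n := maxn M (maxn M1 M2).
have Mn : (M <= n)%N by rewrite leq_maxl.
have /H1 h1 : (M1 <= n)%N by rewrite !leq_max leqnn orbT.
have /H2 h2 : (M2 <= n)%N by rewrite !leq_max leqnn !orbT.
have h3 := sum_le_sub Mn (fr K).
have h4 := sum_le_sub Mn gr.
have h5 := HM n Mn; have h6 := HP K PK.
rewrite normc_distC in h1; rewrite normc_distC in h4.
have t1 := normc_triangle (S K) (\sum_(i < n) f K i) l.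
have t2 := normc_triangle (\sum_(i < n) f K i) (\sum_(i < M) f K i) l.
have t3 := normc_triangle (\sum_(i < M) f K i) (\sum_(i < M) g i) l.
have t4 := normc_triangle (\sum_(i < M) g i) (\sum_(i < n) g i) l.
lra.
Qed.

(** Tannery's theorem with [f K n] the K-th partial sum of row n, dominated by [r n]; [S K] is then
    the K-th partial sum of the column sums. *)
Lemma fubini_csum (a : nat -> nat -> R[i]) (r : nat -> R) (B : R) :
  (forall n K, \sum_(k < K) nc (a n k) <= r n) ->
  (forall n, \sum_(i < n) r i <= B) ->
  exists row col l, [/\ forall n, csum (a n) (row n),
    forall k, csum (a^~ k) (col k), csum row l & csum col l].
Proof.
move=> ar rB.
have /choice[row rowP] n : exists l, csum (a n) l by exact: abs_csum (ar n).
have aler n k : nc (a n k) <= r n.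
  apply: le_trans (ar n k.+1); rewrite big_ord_recr /= lerDr sumr_ge0// => i _.
  exact: normc_ge0.
have /choice[col colP] k : exists l, csum (a^~ k) l.
  by apply: (abs_csum (B := B)) => n; apply: le_trans (rB n); exact: ler_sum.
have lim n (e : R) : 0 < e ->
    exists M, forall K, (M <= K)%N -> nc (\sum_(k < K) a n k - row n) < e.
  by move: e; apply/csumP.
have dom K n : nc (\sum_(k < K) a n k) <= r n.
  exact: le_trans (normc_sum _ _ _) (ar n K).
have [l rowl coll] := tannery lim dom rB (csum_sum colP).
by exists row, col, l; split=> //; apply/csumP.
Qed.

End ComplexSeries.

(** * Power series and analytic continuation *)

Section PowerSeries.
Variable R : realType.
Implicit Types (a c : nat -> R[i]) (s h l v x y : R[i]) (H G : R[i] -> R[i]).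

Lemma geometric_sum_le (q : R) n : 0 <= q < 1 -> \sum_(i < n) q ^+ i <= (1 - q)^-1.
Proof.
move=> /andP[q0 q1]; have q1' : 0 < 1 - q by rewrite subr_gt0.
have E : (1 - q) * \sum_(i < n) q ^+ i = 1 - q ^+ n.
  elim: n => [|n IH]; first by rewrite big_ord0 expr0 mulr0 subrr.
  by rewrite big_ord_recr mulrDr IH exprS; ring.
by rewrite -[leRHS]mul1r ler_pdivlMr// mulrC E gerBl exprn_ge0.
Qed.

Lemma csum_finite a n : (forall k, (n <= k)%N -> a k = 0) ->
  csum a (\sum_(i < n) a i).
Proof.
move=> a0; apply/csumP => e e0; exists n => m nm.
rewrite -!(big_mkord xpredT a) (big_cat_nat (n := n))//= addrC addrK.
by rewrite big_nat_cond big1 ?Normc.normc0// => i /andP[/andP[? _] _]; exact: a0.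
Qed.

Lemma csum_shift a l n : (forall k, (k < n)%N -> a k = 0) -> csum a l ->
  csum (fun k => a (n + k)%N) l.
Proof.
elim: n a => [|n IH] a a0 al; first exact: al.
have := csum_recl al; rewrite (a0 0%N (ltn0Sn n)) subr0 => h.
by apply: eq_csum (IH _ _ h) => [k|k kn]; [rewrite addSn|exact: a0].
Qed.

(** Past rank M consecutive partial sums are within 1 of the limit, whence the 2. Applied to a power
    series at one point, this supplies the coefficient bounds required by [analytic_at]. *)
Lemma csum_bounded a l : csum a l -> exists M : R, forall n, nc (a n) <= M.
Proof.
move=> /csumP/(_ 1 ltr01)[M HM].
have s0 : 0 <= \sum_(i < M) nc (a i) by apply: sumr_ge0 => i _; exact: normc_ge0.
exists (\sum_(i < M) nc (a i) + 2) => n; have [nM|Mn] := ltnP n M.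
  rewrite (bigD1 (Ordinal nM))//= -addrA lerDl addr_ge0//.
  by apply: sumr_ge0 => i _; exact: normc_ge0.
have h1 := HM n Mn; have h2 := HM n.+1 (leqW Mn).
rewrite big_ord_recr /= in h2; rewrite normc_distC in h1.
have := normcD (\sum_(i < n) a i + a n - l) (l - \sum_(i < n) a i).
rewrite addrA subrK addrC addKr.
by lra.
Qed.

Lemma power_sum_le a (rho M : R) x N : 0 < rho -> nc x < rho ->
  (forall n, nc (a n) * rho ^+ n <= M) ->
  \sum_(i < N) nc (a i) * nc x ^+ i <= M * (1 - nc x / rho)^-1.
Proof.
move=> r0 xr aM; have M0 : 0 <= M.
  by apply: le_trans (aM 0%N); rewrite mulr_ge0 ?normc_ge0.
have q : 0 <= nc x / rho < 1.
  by rewrite divr_ge0 ?normc_ge0 ?ltW//= ltr_pdivrMr ?mul1r.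
apply: le_trans (ler_wpM2l M0 (geometric_sum_le N q)).
rewrite mulr_sumr; apply: ler_sum => i _; rewrite expr_div_n.
rewrite (_ : nc (a i) * _ = nc (a i) * rho ^+ i * (nc x ^+ i / rho ^+ i)).
  by rewrite ler_wpM2r// divr_ge0// exprn_ge0 ?normc_ge0 ?ltW.
by field; rewrite expf_neq0 ?gt_eqF.
Qed.

Lemma power_csum a (rho M : R) x : 0 < rho -> nc x < rho ->
  (forall n, nc (a n) * rho ^+ n <= M) -> exists l, csum (fun n => a n * x ^+ n) l.
Proof.
move=> r0 xr aM; apply: (abs_csum (B := M * (1 - nc x / rho)^-1)) => N.
under eq_bigr do rewrite Normc.normcM normcX.
exact: power_sum_le.
Qed.

(** Factor [h] out of the tail: the shifted coefficients are bounded by [M / rho] in place of [M],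
    and a geometric sum of ratio at most 1/2 is at most 2. *)
Lemma power_csum_head a (rho M : R) h l : 0 < rho -> nc h <= rho / 2 ->
  (forall n, nc (a n) * rho ^+ n <= M) -> csum (fun n => a n * h ^+ n) l ->
  nc (l - a 0%N) <= 2 * M / rho * nc h.
Proof.
move=> r0 hr aM /csum_recl; rewrite expr0 mulr1 => al.
apply: (csum_bound al) => n; apply: le_trans (normc_sum _ _ _) _.
have aM' k : nc (a k.+1) * rho ^+ k <= M / rho.
  by rewrite ler_pdivlMr// -mulrA -exprSr.
have hr' : nc h < rho by lra.
have := power_sum_le n r0 hr' aM' => /(ler_wpM2l (normc_ge0 h)).
rewrite mulr_sumr => h1; apply: le_trans (le_trans _ h1) _.
  by apply: ler_sum => i _; rewrite Normc.normcM normcX exprS mulrCA.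
have M0 : 0 <= M / rho by apply: le_trans (aM' 0%N); rewrite mulr_ge0 ?normc_ge0.
rewrite mulrC [2 * M / rho](_ : _ = M / rho * 2); last by field; rewrite gt_eqF.
rewrite ler_wpM2r ?normc_ge0// ler_wpM2l// -[leRHS]invrK lef_pV2 ?posrE//.
  by rewrite lerBrDl -lerBrDr ler_pdivrMr//; lra.
by rewrite subr_gt0 ltr_pdivrMr// mul1r.
Qed.

(** The coefficient bound is kept at the radius [rho] itself, ready for comparison with a geometric
    series, while the expansion is asked only inside the open disc. *)
Definition analytic_at H s := exists c (rho M : R), [/\ 0 < rho,
  forall n, nc (c n) * rho ^+ n <= M &
  forall h, nc h < rho -> csum (fun n => c n * h ^+ n) (H (s + h))].

Definition zero_near H s := exists2 rho : R, 0 < rho &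
  forall h, nc h < rho -> H (s + h) = 0.

Lemma analytic_at_lipschitz H s : analytic_at H s -> exists (C rho : R),
  0 < rho /\ forall h, nc h < rho -> nc (H (s + h) - H s) <= C * nc h.
Proof.
move=> [c [rho [M [r0 cM cH]]]]; exists (2 * M / rho), (rho / 2).
split; first by rewrite divr_gt0.
move=> h hr; have hr' : nc h < rho by lra.
have Hs : H s = c 0%N.
  have := cH 0; rewrite Normc.normc0 addr0 => /(_ r0) /csum_uniq; apply.
  have := @csum_finite (fun n => c n * 0 ^+ n) 1; rewrite big_ord1 expr0 mulr1; apply.
  by case=> // n _; rewrite exprS mul0r mulr0.
by rewrite Hs; apply: power_csum_head (cH _ hr') => //; exact: ltW.
Qed.

(* Isolated zeros: the lowest nonzero coefficient would be the limit of
   H (s + h) / h ^ n along the zeros. *)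
Lemma analytic_at_zero H s : analytic_at H s ->
  (forall e : R, 0 < e -> exists h, [/\ h != 0, nc h < e & H (s + h) = 0]) ->
  zero_near H s.
Proof.
move=> [c [rho [M [r0 cM cH]]]] Hz.
suff c0 n : c n = 0.
  exists rho => // h /cH /csum_uniq; apply.
  by apply: eq_csum (@csum0 R) => n; rewrite c0 mul0r.
elim/ltn_ind: n => n IH.
apply/eqP; rewrite -normc_eq0 eq_le normc_ge0 andbT.
have cM' k : nc (c (n + k)%N) * rho ^+ k <= M / rho ^+ n.
  by rewrite ler_pdivlMr ?exprn_gt0// -mulrA -exprD addnC.
have M0 : 0 <= M / rho ^+ n.
  by apply: le_trans (cM' 0%N); rewrite mulr_ge0 ?normc_ge0.
set C := 2 * (M / rho ^+ n) / rho.
have C0 : 0 <= C by apply: divr_ge0 (ltW r0); exact: mulr_ge0.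
apply/ler_addgt0Pr => e e0; rewrite add0r.
have e1 : 0 < Num.min (rho / 2) (e / (C + 1)).
  by rewrite lt_min !divr_gt0// ltr_wpDl.
have [h [h0 hlt Hh]] := Hz _ e1.
move: hlt; rewrite lt_min => /andP[hr he].
have hr' : nc h < rho by lra.
have hs : csum (fun k => c (n + k)%N * h ^+ k) 0.
  have := cH _ hr'; rewrite Hh => /(@csum_shift _ _ n).
  have z k : (k < n)%N -> c k * h ^+ k = 0 by move=> /IH ->; rewrite mul0r.
  move=> /(_ z) /(csumZ (c := (h ^+ n)^-1)); rewrite mulr0; apply: eq_csum => k.
  by rewrite exprD; field; rewrite expf_neq0.
have := power_csum_head r0 (ltW hr) cM' hs; rewrite sub0r normc_opp addn0.
move=> /le_trans; apply; rewrite -/C.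
move: he; rewrite ltr_pdivlMr ?ltr_wpDl// => /ltW; apply: le_trans.
by rewrite mulrC ler_wpM2l ?normc_ge0// lerDl.
Qed.

Lemma zero_near_open H s : zero_near H s ->
  exists2 rho : R, 0 < rho & forall h, nc h < rho -> zero_near H (s + h).
Proof.
move=> [rho r0 Hr]; exists rho => // h hr.
exists (rho - nc h); first by rewrite subr_gt0.
move=> k kr; rewrite -addrA Hr//; apply: le_lt_trans (normcD _ _) _.
by rewrite -ltrBrDl.
Qed.

(** Connectedness of [0, 1]. Let m be the supremum of the x with P on all of [0, x]: closedness
    gives P m, and openness goes beyond m, which is absurd unless 1 is reached. *)
Lemma real_induction01 (P : R -> Prop) : P 0 ->
  (forall x : R, 0 <= x <= 1 -> P x ->
    exists2 d : R, 0 < d & forall y : R, `|y - x| < d -> P y) ->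
  (forall x : R, 0 <= x <= 1 ->
    (forall d : R, 0 < d -> exists2 y : R, `|y - x| < d & P y) -> P x) ->
  P 1.
Proof.
move=> P0 Po Pc.
pose S := [set x : R | 0 <= x <= 1 /\ forall y : R, 0 <= y <= x -> P y].
have S0 : S 0.
  by split=> [|y]; rewrite ?lexx ?ler01// => /le_anti <-.
have Sub : has_sup S.
  by split; [exists 0|exists 1 => x [/andP[]]].
pose m := sup S.
have m0 : 0 <= m by apply: ub_le_sup => //; case: Sub.
have m1 : m <= 1 by apply: ge_sup; [exists 0|move=> x [/andP[]]].
have adh (d : R) : 0 < d -> exists2 x, S x & m - d < x.
  by move=> d0; have [x Sx] := sup_adherent d0 Sub; exists x.
have lem (x : R) : S x -> x <= m by move=> Sx; apply: ub_le_sup => //; case: Sub.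
have Pm : P m.
  apply: Pc => [|d /adh[x Sx xm]]; first by rewrite m0.
  exists x; last by apply: Sx.2; rewrite lexx andbT; case/andP: Sx.1.
  by rewrite ltr_norml; have := lem _ Sx; case/andP: Sx.1 => *; lra.
have [|d d0 Pd] := Po m _ Pm; first by rewrite m0.
have Pup (y : R) : 0 <= y -> y < m + d -> P y.
  move=> y0 ym; have [ylt|yge] := ltP y m.
    have [|x Sx xm] := adh (m - y); first by rewrite subr_gt0.
    by apply: Sx.2; rewrite y0/=; lra.
  by apply: Pd; rewrite ltr_norml; lra.
have [md|md] := ltP 1 (m + d); first by apply: Pup; rewrite ?ler01.
have /lem : S (m + d / 2); last by lra.
by split=> [|y /andP[y0 ym]]; [lra|apply: Pup => //; lra].
Qed.

(** Identity theorem along a segment. Vanishing near a point is an open condition, and a closed one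
    because an analytic function whose zeros accumulate at a point vanishes near it. *)
Lemma zero_near_continuation H s v :
  (forall x : R, 0 <= x <= 1 -> analytic_at H (s + x%:C * v)) ->
  zero_near H s -> zero_near H (s + v).
Proof.
move=> Han H0; have [->|v0] := eqVneq v 0; first by rewrite addr0.
have nv : 0 < nc v by rewrite normc_gt0.
have stepE (x y : R) : s + y%:C * v = s + x%:C * v + (y - x)%:C * v.
  by rewrite rmorphB /=; ring.
rewrite -[v]mul1r -(rmorph1 (real_complex R)).
apply: (real_induction01 (P := fun x : R => zero_near H (s + x%:C * v))).
- by rewrite rmorph0 mul0r addr0.
- move=> x _ /zero_near_open[rho r0 Hr]; exists (rho / nc v); first by rewrite divr_gt0.
  move=> y; rewrite ltr_pdivlMr// -normc_real -Normc.normcM => /Hr.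
  by rewrite -stepE.
- move=> x /Han Hx Hz; apply: analytic_at_zero Hx _ => e e0.
  have e2 : 0 < e / 2 by rewrite divr_gt0.
  have [y yx [rho r0 Hr]] := Hz (e / 2 / nc v) (divr_gt0 e2 nv).
  (* The zeros must differ from the limit point, and [w] may be 0. As H vanishes on a disc around
     [s + y%:C * v], the offset [w + r%:C] serves as well, and one of the two is nonzero. *)
  pose r := Num.min (rho / 2) (e / 4).
  have rr : 0 < r by rewrite lt_min !divr_gt0.
  have rlt : r < rho by rewrite gt_min; apply/orP; left; lra.
  have rle : r <= e / 4 by rewrite ge_min lexx orbT.
  move: yx; rewrite ltr_pdivlMr// -normc_real -Normc.normcM => yx.
  set w := (y - x)%:C * v in yx.
  have [w0|w0] := eqVneq (w + r%:C) 0; last first.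
    exists (w + r%:C); split=> //.
      apply: le_lt_trans (normcD _ _) _; rewrite normc_real gtr0_norm//; lra.
    by rewrite addrA -stepE Hr// normc_real gtr0_norm.
  exists w; split.
  - by apply/eqP => wz; move: w0; rewrite wz add0r => -[r0']; rewrite r0' ltxx in rr.
  - by lra.
  - by rewrite -stepE -[_ + _]addr0 Hr// Normc.normc0.
Qed.

Lemma analytic_atB H G s : analytic_at H s -> analytic_at G s ->
  analytic_at (fun x => H x - G x) s.
Proof.
move=> [c [r [M [r0 cM cH]]]] [d [t [N [t0 dN dG]]]].
pose u := Num.min r t; have u0 : 0 < u by rewrite lt_min r0.
have le_bound (f : nat -> R[i]) (p K : R) n : u <= p -> nc (f n) * p ^+ n <= K ->
    nc (f n) * u ^+ n <= K.
  move=> up; apply: le_trans; rewrite ler_wpM2l ?normc_ge0//.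
  by rewrite lerXn2r// nnegrE ltW// (lt_le_trans u0).
exists (fun n => c n - d n), u, (M + N); split=> // [n|h].
  apply: le_trans (_ : (nc (c n) + nc (d n)) * u ^+ n <= _).
    by rewrite ler_wpM2r ?normcB// exprn_ge0// ltW.
  rewrite mulrDl lerD//; first by apply: le_bound (cM n); rewrite ge_min lexx.
  by apply: le_bound (dN n); rewrite ge_min lexx orbT.
rewrite lt_min => /andP[/cH h1 /dG h2].
by apply: eq_csum (csumB h1 h2) => n; rewrite mulrBl.
Qed.

Lemma sum_trunc_le (F : nat -> R) N K : (forall k, 0 <= F k) ->
  (forall k, (N <= k)%N -> F k = 0) -> \sum_(k < K) F k <= \sum_(k < N) F k.
Proof.
move=> F0 FN; rewrite -!(big_mkord xpredT F).
have [KN|/ltnW NK] := leqP K N.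
  by rewrite [leRHS](big_cat_nat (n := K))//= lerDl sumr_ge0.
rewrite (big_cat_nat (n := N))//= [X in _ + X]big_nat_cond [X in _ + X]big1 ?addr0//.
by move=> i /andP[/andP[? _] _]; exact: FN.
Qed.

(** Re-expansion at [s]: each (s + h)^n is developed by the binomial theorem and the double sum is
    rearranged; it converges absolutely because [nc s + r < rho]. *)
Lemma power_series_analytic a G (rho M : R) s : nc s < rho ->
  (forall n, nc (a n) * rho ^+ n <= M) ->
  (forall x, nc x < rho -> csum (fun n => a n * x ^+ n) (G x)) ->
  analytic_at G s.
Proof.
move=> sr aM aG; pose r := (rho - nc s) / 2.
have r0 : 0 < r by rewrite divr_gt0// subr_gt0.
have rho0 : 0 < rho by apply: le_lt_trans sr; exact: normc_ge0.
(* ['C(n, m)] vanishes for m > n, which lets m run over all natural numbers. *)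
pose t n m h : R[i] := a n * ('C(n, m)%:R * s ^+ (n - m) * h ^+ m).
pose u := nc s + r.
have u0 : 0 <= u by rewrite addr_ge0 ?normc_ge0// ltW.
have ncu : nc u%:C = u by rewrite normc_real ger0_norm.
have row_le n K h : nc h <= r -> \sum_(m < K) nc (t n m h) <= nc (a n) * u ^+ n.
  move=> hr.
  apply: (@le_trans _ _ (\sum_(m < K) nc (a n) * (nc s ^+ (n - m) * r ^+ m *+ 'C(n, m)))).
    apply: ler_sum => m _; rewrite /t !Normc.normcM !normcX normc_nat.
    rewrite ler_wpM2l ?normc_ge0// -mulrA mulr_natl lerMn2r.
    by rewrite ler_wpM2l ?exprn_ge0 ?normc_ge0 ?orbT// lerXn2r ?nnegrE ?normc_ge0// ?orbT ltW.
  rewrite -mulr_sumr ler_wpM2l ?normc_ge0// /u exprDn.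
  apply: sum_trunc_le (fun m => nc s ^+ (n - m) * r ^+ m *+ 'C(n, m)) _ _ _ _ => k.
    by rewrite mulrn_wge0// mulr_ge0// exprn_ge0 ?normc_ge0// ltW.
  by move=> nk; rewrite bin_small// mulr0n.
pose B := M * (1 - u / rho)^-1.
have rows_le N : \sum_(n < N) nc (a n) * u ^+ n <= B.
  have := @power_sum_le a rho M u%:C N rho0; rewrite ncu; apply=> //.
  by rewrite /u /r; lra.
(* A single entry of the row at [h = r] is at most the row sum, so column m converges absolutely,
   with bound [B / r ^+ m]. *)
have /choice[c cP] m : exists l, csum (fun n => a n * ('C(n, m)%:R * s ^+ (n - m))) l.
  apply: (abs_csum (B := B / r ^+ m)) => N.
  rewrite ler_pdivlMr ?exprn_gt0// mulr_suml; apply: le_trans (rows_le N).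
  apply: ler_sum => n _; apply: le_trans (row_le n m.+1 r%:C _); last first.
    by rewrite normc_real gtr0_norm.
  rewrite big_ord_recr /= (_ : _ * r ^+ m = nc (t n m r%:C)); last first.
    by rewrite /t [in RHS]mulrA [RHS]Normc.normcM normcX normc_real gtr0_norm.
  by rewrite lerDr sumr_ge0// => i _; exact: normc_ge0.
exists c, r, B; split=> // [m|h hr].
  rewrite -{1}(gtr0_norm r0) -normc_real -normcX -Normc.normcM mulrC.
  apply: csum_bound (csumZ (cP m)) _ => N; apply: le_trans (normc_sum _ _ _) _.
  apply: le_trans (rows_le N).
  apply: ler_sum => n _; apply: le_trans (row_le n m.+1 r%:C _); last first.
    by rewrite normc_real gtr0_norm.
  rewrite big_ord_recr /= (_ : r%:C ^+ m * _ = t n m r%:C); last first.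
    by rewrite /t; ring.
  by rewrite lerDr sumr_ge0// => i _; exact: normc_ge0.
have [row [col [l [rowP colP rowl coll]]]] := fubini_csum
  (a := fun n m => t n m h) (fun n K => row_le n K h (ltW hr)) rows_le.
have rowE n : row n = a n * (s + h) ^+ n.
  apply: csum_uniq (rowP n) _; rewrite exprDn.
  rewrite (eq_bigr (fun i : 'I_n.+1 => 'C(n, i)%:R * s ^+ (n - i) * h ^+ i)); last first.
    by move=> i _; rewrite -mulr_natl mulrA.
  rewrite mulr_sumr; apply: (@csum_finite (fun m => t n m h)) => k nk.
  by rewrite /t bin_small// mul0r mul0r mulr0.
have colE m : col m = c m * h ^+ m.
  apply: csum_uniq (colP m) _; rewrite mulrC.
  by apply: eq_csum (csumZ (cP m)) => n; rewrite /t; ring.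
have -> : G (s + h) = l.
  have /aG : nc (s + h) < rho.
    by apply: le_lt_trans (normcD _ _) _; rewrite /r in hr; lra.
  by move=> /csum_uniq; apply; apply: eq_csum rowl.
exact: eq_csum coll.
Qed.

(** Summation by parts, with the deviations of the partial sums from [l] in place of the
    coefficients. *)
Lemma abel_partial a l x N :
  \sum_(n < N) a n * x ^+ n - l =
  (\sum_(i < N) a i - l) * x ^+ N +
  (1 - x) * \sum_(n < N) (\sum_(i < n.+1) a i - l) * x ^+ n.
Proof.
elim: N => [|N IH]; first by rewrite !big_ord0 expr0; ring.
rewrite big_ord_recr /= addrAC IH [X in _ = _ + _ * X]big_ord_recr /= exprS.
rewrite (_ : \sum_(i < N.+1) a i = \sum_(i < N) a i + a N); first by ring.
by rewrite big_ord_recr.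
Qed.

(** Abel's theorem in a Stolz region. Deviations past rank M are small and their total weight
    [(1 - nc x)^-1] is compensated by the Stolz condition; the first M are damped by the factor
    [nc (1 - x)]. *)
Lemma abel_stolz a l (C e : R) : csum a l -> 0 < e ->
  exists2 d : R, 0 < d & forall x, nc x < 1 -> nc (1 - x) <= C * (1 - nc x) ->
    nc (1 - x) < d -> forall m, csum (fun n => a n * x ^+ n) m -> nc (m - l) < e.
Proof.
move=> /csumP al e0.
(* C has no prescribed sign; this D ensures [(1 + C) / D < 1]. *)
pose D := `|C| + 2; have D0 : 0 < D by rewrite /D ltr_wpDl.
have eD : 0 < e / 2 / D by rewrite !divr_gt0.
have [M HM] := al _ eD.
pose K := \sum_(n < M) nc (\sum_(i < n.+1) a i - l).
have K0 : 0 <= K by apply: sumr_ge0 => i _; exact: normc_ge0.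
exists (e / 2 / (K + 1)); first by rewrite !divr_gt0// ltr_wpDl.
move=> x x1 xC xd m /csumP am.
have K1 : 0 < K + 1 by rewrite ltr_wpDl.
have x1' : 0 < 1 - nc x by rewrite subr_gt0.
have X0 n : 0 <= nc x ^+ n by rewrite exprn_ge0 ?normc_ge0.
have part N : (M <= N)%N -> nc (\sum_(n < N) a n * x ^+ n - l) <=
    e / 2 / D + nc (1 - x) * K + e / 2 / D * C.
  move=> MN; rewrite abel_partial; apply: le_trans (normcD _ _) _.
  rewrite -addrA; apply: lerD.
    rewrite Normc.normcM normcX -[leRHS]mulr1; apply: ler_pM; rewrite ?normc_ge0//.
      by rewrite ltW// HM.
    by rewrite exprn_ile1 ?normc_ge0// ltW.
  rewrite Normc.normcM; apply: le_trans (_ : nc (1 - x) *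
     (K + e / 2 / D * (1 - nc x)^-1) <= _).
    rewrite ler_wpM2l ?normc_ge0//; apply: le_trans (normc_sum _ _ _) _.
    rewrite -(big_mkord xpredT (fun n => nc ((\sum_(i < n.+1) a i - l) * x ^+ n))).
    rewrite (big_cat_nat (n := M))//= lerD//.
      rewrite big_mkord; apply: ler_sum => n _.
      rewrite Normc.normcM normcX ler_piMr ?normc_ge0//.
      by rewrite exprn_ile1 ?normc_ge0// ltW.
    apply: le_trans (_ : \sum_(M <= n < N) e / 2 / D * nc x ^+ n <= _).
      rewrite big_nat_cond [leRHS]big_nat_cond; apply: ler_sum => n.
      move=> /andP[/andP[Mn _] _]; rewrite Normc.normcM normcX ler_wpM2r//.
      by rewrite ltW// HM// leqW.
    rewrite -mulr_sumr ler_wpM2l ?(ltW eD)//.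
    apply: le_trans (_ : \sum_(0 <= n < N) nc x ^+ n <= _).
      by rewrite [leRHS](big_cat_nat (n := M))//= lerDr sumr_ge0.
    by rewrite big_mkord geometric_sum_le// normc_ge0.
  rewrite mulrDr lerD// mulrCA ler_wpM2l ?(ltW eD)//.
  by rewrite ler_pdivrMr.
have hK : nc (1 - x) * K <= e / 2 * (K / (K + 1)).
  by rewrite mulrA [leRHS]mulrAC ler_wpM2r// ltW.
have hC : e / 2 / D * (1 + C) < e / 2.
  rewrite mulrAC ltr_pdivrMr// ltr_pM2l ?divr_gt0// /D.
  by have := ler_norm C; lra.
have hKK : e / 2 * (K / (K + 1)) < e / 2.
  by rewrite -[ltRHS]mulr1 ltr_pM2l ?divr_gt0// ltr_pdivrMr// mul1r ltrDl.
(* The room left below [e] absorbs the distance between a partial sum and [m]. *)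
pose slack := e - (e / 2 / D * (1 + C) + e / 2 * (K / (K + 1))).
have sl0 : 0 < slack by rewrite /slack; lra.
have [P HP] := am _ sl0.
have h1 := HP (maxn M P) (leq_maxr _ _); have h2 := part (maxn M P) (leq_maxl _ _).
have := normc_triangle m (\sum_(n < maxn M P) a n * x ^+ n) l.
rewrite normc_distC in h1; rewrite /slack in h1.
by move: h1 h2 hK; rewrite mulrDr mulr1; lra.
Qed.

End PowerSeries.

(** * Principal powers and the binomial series *)

Section ComplexExponential.
Variable R : realType.
Implicit Types (z w g t : R[i]).

Lemma Cexp0 : Cexp (0 : R[i]) = 1.
Proof. by rewrite /Cexp /= expR0 cos0 sin0 mul1r. Qed.

Lemma CexpD z w : Cexp (z + w) = Cexp z * Cexp w.
Proof.
case: z w => [a b] [c d]; rewrite /Cexp /= expRD cosD sinD rmorphM /=.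
by apply/eqP; rewrite eq_complex /=; apply/andP; split; apply/eqP; ring.
Qed.

Lemma CexpMn z n : Cexp (n%:R * z) = Cexp z ^+ n.
Proof.
elim: n => [|n IH]; first by rewrite mul0r Cexp0.
by rewrite -natr1 mulrDl mul1r CexpD IH exprSr.
Qed.

Lemma CexpN z : Cexp (- z) * Cexp z = 1.
Proof. by rewrite -CexpD addNr Cexp0. Qed.

Lemma normc_Cexp z : nc (Cexp z) = expR (complex.Re z).
Proof.
rewrite /Cexp Normc.normcM normc_real gtr0_norm ?expR_gt0//= cos2Dsin2.
by rewrite sqrtr1 mulr1.
Qed.

Lemma Cexp_neq0 z : Cexp z != 0.
Proof. by rewrite -normc_gt0 normc_Cexp expR_gt0. Qed.

(** [acos] recovers Im w up to sign, and on this strip the sign of the sine, tested in [Carg],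
    restores it. *)
Lemma Clog_Cexp w : - pi < complex.Im w < pi -> Clog (Cexp w) = w.
Proof.
move=> /andP[w1 w2]; rewrite /Clog normc_Cexp expRK /Carg normc_Cexp.
case: w w1 w2 => a b /= b1 b2; rewrite !mul0r subr0 addr0.
have e0 := expR_gt0 a.
rewrite mulrAC divff ?gt_eqF// mul1r pmulr_rge0//; congr (_ +i* _).
have [b0|b0] := leP 0 b.
  by rewrite sin_ge0_pi ?b0 ?ltW// cosK// in_itv/= b0 ltW.
have : 0 < sin (- b) by rewrite sin_gt0_pi// oppr_gt0 b0 ltrNl.
by rewrite sinN oppr_gt0 ltNge => /negbTE ->; rewrite cosKN ?opprK// !ltW.
Qed.

Lemma Clog_real (u : R) : 0 < u -> Clog u%:C = (ln u)%:C.
Proof.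
move=> u0; rewrite -[LHS](_ : Clog (Cexp (ln u)%:C) = _).
  by rewrite Clog_Cexp//= oppr_lt0 pi_gt0.
by rewrite /Cexp /= lnK// cos0 sin0 mulr1.
Qed.

Lemma Cexp_ln_atan (x y : R) : 0 < x ->
  Cexp (ln (nc (x +i* y)) +i* atan (y / x)) = x +i* y.
Proof.
move=> x0; have n0 : 0 < nc (x +i* y).
  by rewrite normc_gt0 eq_complex /= gt_eqF.
have c0 : 0 < cos (atan (y / x)).
  by apply: cos_gt0_pihalf; rewrite atan_gtNpi2 atan_ltpi2.
have nE : nc (x +i* y) = x / cos (atan (y / x)).
  rewrite cos_atan invrK /=.
  rewrite (_ : x ^+ 2 + y ^+ 2 = x ^+ 2 * (1 + (y / x) ^+ 2)).
    by rewrite sqrtrM ?sqr_ge0// sqrtr_sqr gtr0_norm.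
  by field; rewrite gt_eqF.
have sE : sin (atan (y / x)) = y / x * cos (atan (y / x)).
  by rewrite -{2}[y / x]atanK /tan; field; rewrite gt_eqF.
move: (nc _) n0 nE => r n0 nE; rewrite /Cexp /= lnK ?posrE// sE nE; apply/eqP;
  rewrite eq_complex /=.
by apply/andP; split; apply/eqP; field; rewrite !gt_eqF.
Qed.

(** On the right half-plane the argument becomes an arctangent, which can be differentiated without
    the case split of [Carg]. *)
Lemma Clog_atan (x y : R) : 0 < x ->
  Clog (x +i* y) = ln (nc (x +i* y)) +i* atan (y / x).
Proof.
move=> x0; rewrite -[in LHS](Cexp_ln_atan y x0) Clog_Cexp//=.
have := atan_gtNpi2 (y / x); have := atan_ltpi2 (y / x); have := pi_gt0 R.
by move=> *; apply/andP; split; lra.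
Qed.

Lemma Cexp_Clog z : 0 < complex.Re z -> Cexp (Clog z) = z.
Proof. by case: z => x y /= x0; rewrite Clog_atan// Cexp_ln_atan. Qed.

Lemma Clog_strip z : 0 < complex.Re z -> - (pi / 2) < complex.Im (Clog z) < pi / 2.
Proof. by case: z => x y x0; rewrite Clog_atan//= atan_gtNpi2 atan_ltpi2. Qed.

(** Both arguments lie in ]-pi/2, pi/2[, so their sum does not cross the branch cut. *)
Lemma ClogM z w : 0 < complex.Re z -> 0 < complex.Re w ->
  Clog (z * w) = Clog z + Clog w.
Proof.
move=> z0 w0; rewrite -{1}(Cexp_Clog z0) -{1}(Cexp_Clog w0) -CexpD Clog_Cexp//.
have /andP[z1 z2] := Clog_strip z0; have /andP[w1 w2] := Clog_strip w0.
move: (Clog z) (Clog w) z1 z2 w1 w2 => [a b] [c d] /= *.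
by apply/andP; split; lra.
Qed.

Lemma CpowM z w g : 0 < complex.Re z -> 0 < complex.Re w ->
  Cpow (z * w) g = Cpow z g * Cpow w g.
Proof. by move=> z0 w0; rewrite /Cpow ClogM// mulrDr CexpD. Qed.

Lemma CpowBn z g n : 0 < complex.Re z -> Cpow z (- (g + n%:R)) = Cpow z (- g) / z ^+ n.
Proof.
move=> z0; rewrite /Cpow opprD mulrDl CexpD; congr (_ * _).
have := CexpN (n%:R * Clog z); rewrite CexpMn Cexp_Clog// mulNr => h.
have zn : z ^+ n != 0 by rewrite expf_neq0// -(Cexp_Clog z0) Cexp_neq0.
by apply: (mulIf zn); rewrite h mulVf.
Qed.

Lemma Carg_le_pi z : `|Carg z| <= pi.
Proof.
rewrite /Carg; set c := _ / _.
have c1 : -1 <= c <= 1.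
  rewrite -ler_norml normrM normfV (ger0_norm (normc_ge0 z)).
  (* At 0 the quotient is 0, because the inverse of 0 is 0. *)
  have [->|z0] := eqVneq z 0; first by rewrite Normc.normc0 invr0 mulr0.
  by rewrite ler_pdivrMr ?normc_gt0// mul1r ler_Re_normc.
have a0 := acos_ge0 c1; have a1 := acos_lepi c1.
by case: ifP => _; rewrite ?normrN ger0_norm.
Qed.

Lemma normc_CpowV_le z g : nc (Cpow z g)^-1 <=
  expR (`|complex.Re g| * `|ln (nc z)| + `|complex.Im g| * pi).
Proof.
rewrite Normc.normcV normc_Cexp -expRN ler_expR.
case: g => a b /=; rewrite opprB -[leRHS]addrC; apply: lerD.
  by apply: le_trans (ler_norm _) _; rewrite normrM ler_wpM2l// Carg_le_pi.
by apply: le_trans (ler_norm _) _; rewrite normrN normrM.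
Qed.

End ComplexExponential.

(** * Differentiation along a ray and the binomial series *)

Section Binomial.
Variable R : realType.
Implicit Types (z w g t : R[i]) (f : R -> R[i]) (x : R).

(** Componentwise, so that the real differentiation rules and the mean value theorem apply to each
    part. *)
Definition cderiv f x (l : R[i]) :=
  is_derive x 1 (fun y => complex.Re (f y)) (complex.Re l) /\
  is_derive x 1 (fun y => complex.Im (f y)) (complex.Im l).

Lemma cderivM f1 f2 x l1 l2 : cderiv f1 x l1 -> cderiv f2 x l2 ->
  cderiv (fun y => f1 y * f2 y) x (l1 * f2 x + f1 x * l2).
Proof.
move=> [dr1 di1] [dr2 di2]; split.
  rewrite (_ : (fun y => _) = (fun y => complex.Re (f1 y)) * (fun y => complex.Re (f2 y)) -
     (fun y => complex.Im (f1 y)) * (fun y => complex.Im (f2 y))); last first.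
    by apply/funext => y; rewrite !fctE; case: (f1 y) (f2 y) => [? ?] [? ?].
  apply: is_derive_eq; rewrite /GRing.scale /=.
  by case: (f1 x) (f2 x) l1 l2 {dr1 dr2 di1 di2} => ? ? [? ?] [? ?] [? ?] /=; ring.
rewrite (_ : (fun y => _) = (fun y => complex.Re (f1 y)) * (fun y => complex.Im (f2 y)) +
   (fun y => complex.Im (f1 y)) * (fun y => complex.Re (f2 y))); last first.
  by apply/funext => y; rewrite !fctE; case: (f1 y) (f2 y) => [? ?] [? ?].
apply: is_derive_eq; rewrite /GRing.scale /=.
by case: (f1 x) (f2 x) l1 l2 {dr1 dr2 di1 di2} => ? ? [? ?] [? ?] [? ?] /=; ring.
Qed.

Lemma cderiv_cst g x : cderiv (fun=> g) x 0.
Proof. by split; exact: is_derive_cst. Qed.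

Lemma cderiv_Cexp f x l : cderiv f x l -> cderiv (fun y => Cexp (f y)) x (l * Cexp (f x)).
Proof.
move=> [dr di]; split.
  rewrite (_ : (fun y => _) = (expR \o (fun y => complex.Re (f y))) *
     (cos \o (fun y => complex.Im (f y)))); last first.
    by apply/funext => y /=; rewrite fctE mul0r subr0.
  apply: is_derive_eq; rewrite /GRing.scale /=.
  by case: (f x) l {dr di} => ? ? [? ?] /=; ring.
rewrite (_ : (fun y => _) = (expR \o (fun y => complex.Re (f y))) *
   (sin \o (fun y => complex.Im (f y)))); last first.
  by apply/funext => y /=; rewrite fctE mul0r addr0.
apply: is_derive_eq; rewrite /GRing.scale /=.
by case: (f x) l {dr di} => ? ? [? ?] /=; ring.
Qed.

Lemma cderiv0_eq f : (forall x, 0 <= x <= 1 -> cderiv f x 0) -> f 1 = f 0.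
Proof.
move=> df.
have cst (h : R -> R) : (forall x, 0 <= x <= 1 -> is_derive x 1 h 0) -> h 1 = h 0.
  move=> dh; have [||c _] := @MVT R h (fun=> 0) 0 1 ltr01.
  - by move=> x; rewrite in_itv/= => /andP[? ?]; apply: dh; rewrite !ltW.
  - apply: derivable_within_continuous => x; rewrite in_itv/= => /dh h0;
    exact: (@ex_derive _ _ _ _ _ _ _ h0).
  - by rewrite mul0r => /eqP; rewrite subr_eq0 => /eqP.
apply/eqP; rewrite eq_complex; apply/andP; split; apply/eqP.
  by apply: (cst (fun x => complex.Re (f x))) => x /df[].
by apply: (cst (fun x => complex.Im (f x))) => x /df[].
Qed.

(* x |-> log (1 - x t) *)
Definition log_ray t x : R[i] :=
  ln ((1 - x * complex.Re t) ^+ 2 + (x * complex.Im t) ^+ 2) / 2 +i*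
  atan (- (x * complex.Im t) / (1 - x * complex.Re t)).

Lemma Clog_ray t x : 0 < 1 - x * complex.Re t -> Clog (1 - x%:C * t) = log_ray t x.
Proof.
case: t => a b /= u0.
have -> : 1 - x%:C * (a +i* b) = (1 - x * a) +i* (- (x * b)).
  by apply/eqP; rewrite eq_complex /=; apply/andP; split; apply/eqP; ring.
rewrite Clog_atan// /log_ray /= sqrrN; congr (_ +i* _).
set v := _ + _; have v0 : 0 < v by rewrite ltr_wpDr ?sqr_ge0 ?exprn_gt0.
have -> : ln v = ln (Num.sqrt v) * 2.
  by rewrite -[in LHS](sqr_sqrtr (ltW v0)) lnXn ?sqrtr_gt0// mulr_natr.
by rewrite mulfK// pnatr_eq0.
Qed.

Lemma cderiv_log_ray t x : 0 < 1 - x * complex.Re t ->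
  cderiv (log_ray t) x (- t / (1 - x%:C * t)).
Proof.
case: t => a b /= u0.
(* [1 - x%:C * t] has real part [u x] and imaginary part [- w x]; [v] is its squared modulus. *)
pose u : R -> R := cst 1 - id * cst a; pose w : R -> R := id * cst b.
have ux0 : u x != 0 by rewrite gt_eqF.
have du : is_derive x 1 u (- a).
  by apply: is_derive_eq; rewrite /GRing.scale /=; ring.
have dw : is_derive x 1 w b.
  by apply: is_derive_eq; rewrite /GRing.scale /=; ring.
pose v : R -> R := u ^+ 2 + w ^+ 2.
have v0 : 0 < v x by rewrite /v !fctE ltr_wpDr ?sqr_ge0 ?exprn_gt0.
have vE : v x = (1 - x * a) ^+ 2 + (x * b) ^+ 2 by [].
have dv : is_derive x 1 v (- 2 * a * u x + 2 * b * w x).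
  have := is_deriveD (is_deriveX 2 du) (is_deriveX 2 dw).
  by move=> /is_derive_eq; apply; rewrite /GRing.scale /=; ring.
have invE : (1 - x%:C * (a +i* b))^-1 = (u x / v x) +i* (w x / v x).
  have -> : 1 - x%:C * (a +i* b) = (1 - x * a) +i* (- (x * b)).
    by apply/eqP; rewrite eq_complex /=; apply/andP; split; apply/eqP; ring.
  apply/eqP; rewrite eq_complex /= vE sqrrN; apply/andP; split; apply/eqP => //.
  by rewrite mulNr opprK.
rewrite invE; split => /=.
  have dl := is_deriveZ 2^-1 (is_derive1_comp (is_derive1_ln v0) dv).
  rewrite (_ : (fun y => _) = 2^-1 \*: (@ln R \o v)); last first.
    by apply/funext => y; rewrite /= mulrC.
  move: dl => /is_derive_eq; apply; rewrite /GRing.scale /=.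
  by field; rewrite gt_eqF.
have dq := is_derive1_comp (is_derive1_atan _) (is_deriveM (is_deriveN dw) (is_deriveV ux0 du)).
rewrite (_ : (fun y => _) = atan \o (- w * (fun y => (u y)^-1))) //.
move: dq => /is_derive_eq; apply; rewrite /GRing.scale /= !fctE.
have -> : v x = u x ^+ 2 + w x ^+ 2 by [].
have v0' : u x ^+ 2 + w x ^+ 2 != 0 by rewrite gt_eqF.
by field; rewrite ux0 v0'.
Qed.

Lemma csum_Re (a : nat -> R[i]) l : csum a l ->
  series (fun n => complex.Re (a n)) @ \oo --> complex.Re l.
Proof.
move=> /csumP al; apply/cvgrPdist_lt => e e0; have [M HM] := al e e0.
exists M => // n /HM; apply: le_lt_trans; rewrite distrC /series /= big_mkord.
by rewrite -raddf_sum -raddfB ler_Re_normc.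
Qed.

Lemma csum_Im (a : nat -> R[i]) l : csum a l ->
  series (fun n => complex.Im (a n)) @ \oo --> complex.Im l.
Proof.
move=> /csumP al; apply/cvgrPdist_lt => e e0; have [M HM] := al e e0.
exists M => // n /HM; apply: le_lt_trans; rewrite distrC /series /= big_mkord.
by rewrite -raddf_sum -raddfB ler_Im_normc.
Qed.

Lemma csum_cons (a : nat -> R[i]) l : csum (fun n => a n.+1) l -> csum a (a 0%N + l).
Proof.
move=> /csumP al; apply/csumP => e e0; have [M HM] := al e e0.
exists M.+1 => -[//|n]; rewrite ltnS => /HM; congr (nc _ < _).
by rewrite big_ord_recl opprD addrACA subrr add0r.
Qed.

Definition ray_sum (c : nat -> R[i]) x : R[i] :=
  limn (pseries (fun n => complex.Re (c n)) x) +i*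
  limn (pseries (fun n => complex.Im (c n)) x).

Lemma ReMreal z x n : complex.Re (z * x%:C ^+ n) = complex.Re z * x ^+ n.
Proof. by rewrite -rmorphXn; case: z => a b /=; rewrite mulr0 subr0. Qed.

Lemma ImMreal z x n : complex.Im (z * x%:C ^+ n) = complex.Im z * x ^+ n.
Proof. by rewrite -rmorphXn; case: z => a b /=; rewrite mulr0 add0r. Qed.

Lemma csum_pseries c x l : csum (fun n => c n * x%:C ^+ n) l ->
  pseries (fun n => complex.Re (c n)) x @ \oo --> complex.Re l /\
  pseries (fun n => complex.Im (c n)) x @ \oo --> complex.Im l.
Proof.
move=> h; have := csum_Re h; have := csum_Im h.
have -> : (fun n => complex.Im (c n * x%:C ^+ n)) = fun n => complex.Im (c n) * x ^+ n.
  by apply/funext => n; rewrite ImMreal.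
have -> : (fun n => complex.Re (c n * x%:C ^+ n)) = fun n => complex.Re (c n) * x ^+ n.
  by apply/funext => n; rewrite ReMreal.
by [].
Qed.

Lemma ray_sumE c x l : csum (fun n => c n * x%:C ^+ n) l -> ray_sum c x = l.
Proof.
move=> /csum_pseries[/cvg_lim h1 /cvg_lim h2].
by rewrite /ray_sum h1// h2//; case: l {h1 h2}.
Qed.

(** Termwise differentiation of both components; [c1] and [c2] are the coefficients of the first two
    formal derivatives. *)
Lemma cderiv_ray_sum (c : nat -> R[i]) (K : R) x l0 l1 l2 :
  let c1 n := n.+1%:R * c n.+1 in let c2 n := n.+1%:R * c1 n.+1 in
  csum (fun n => c n * K%:C ^+ n) l0 -> csum (fun n => c1 n * K%:C ^+ n) l1 ->
  csum (fun n => c2 n * K%:C ^+ n) l2 -> `|x| < `|K| ->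
  cderiv (ray_sum c) x (ray_sum c1 x).
Proof.
move=> c1 c2 /csum_pseries[r0 i0] /csum_pseries[r1 i1] /csum_pseries[r2 i2] xK.
have ReE (d : nat -> R[i]) : (fun n => complex.Re (n.+1%:R * d n.+1)) =
    pseries_diffs (fun n => complex.Re (d n)).
  apply/funext => n; rewrite /pseries_diffs -(rmorph_nat (real_complex R)).
  by case: (d n.+1) => a b /=; rewrite mul0r subr0.
have ImE (d : nat -> R[i]) : (fun n => complex.Im (n.+1%:R * d n.+1)) =
    pseries_diffs (fun n => complex.Im (d n)).
  apply/funext => n; rewrite /pseries_diffs -(rmorph_nat (real_complex R)).
  by case: (d n.+1) => a b /=; rewrite mul0r addr0.
rewrite /c2 !ReE in r2; rewrite /c2 !ImE in i2.
rewrite /c1 !ReE in r1 r2; rewrite /c1 !ImE in i1 i2.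
split; rewrite /ray_sum /= /c1 ?ReE ?ImE; apply: (pseries_snd_diffs (K := K)) => //.
- by apply/cvg_ex; eexists; exact: r0.
- by apply/cvg_ex; eexists; exact: r1.
- by apply/cvg_ex; eexists; exact: r2.
- by apply/cvg_ex; eexists; exact: i0.
- by apply/cvg_ex; eexists; exact: i1.
- by apply/cvg_ex; eexists; exact: i2.
Qed.

Lemma pochS g n : poch g n.+1 = poch g n * (g + n%:R).
Proof. by rewrite /poch big_ord_recr. Qed.

Lemma pochD g n k : poch g (n + k) = poch g n * poch (g + n%:R) k.
Proof.
elim: k => [|k IH]; first by rewrite addn0 /poch big_ord0 mulr1.
by rewrite addnS !pochS IH natrD -!mulrA addrA.
Qed.

(* Coefficient of t ^ n in the binomial series of (1 - t) ^ (- g). *)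
Definition bcoef g n := poch g n / n`!%:R.

Lemma fact_neq0 n : n`!%:R != 0 :> R[i].
Proof. by rewrite pnatr_eq0 -lt0n fact_gt0. Qed.

Lemma bcoef0 g : bcoef g 0 = 1.
Proof. by rewrite /bcoef /poch big_ord0 divr1. Qed.

(** Coefficient form of the equation (1 - t) f' = g f. *)
Lemma bcoefS g n : n.+1%:R * bcoef g n.+1 = (g + n%:R) * bcoef g n.
Proof.
rewrite /bcoef pochS factS natrM; field.
by rewrite fact_neq0 nat1r pnatr_eq0.
Qed.

(** Coefficient form of the fact that (1 - t)^(-g) has derivative g (1 - t)^(-g - 1). *)
Lemma bcoef_shift g n : n.+1%:R * bcoef g n.+1 = g * bcoef (g + 1) n.
Proof.
have pochSl : poch g n.+1 = g * poch (g + 1) n.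
  by rewrite -add1n pochD /poch big_ord1 addr0.
by rewrite bcoefS /bcoef mulrA [_ * poch g n]mulrC -pochS pochSl mulrA.
Qed.

Lemma bcoefM g n k : bcoef g n * bcoef (g + n%:R) k =
  poch g (n + k) / (n`!%:R * k`!%:R).
Proof. by rewrite pochD /bcoef; field; rewrite !fact_neq0. Qed.

(** The majorant is the coefficient of (1 - t)^(-m - 1): each factor [g + i%:R] has modulus at most
    m + 1 + i. *)
Lemma bcoef_le g m n : nc g <= m.+1%:R -> nc (bcoef g n) <= 'C(m + n, n)%:R.
Proof.
move=> gm; elim: n => [|n IH]; first by rewrite bcoef0 Normc.normc1 bin0.
have n0 : 0 < (n.+1%:R : R) by rewrite ltr0n.
rewrite -(ler_pM2l n0).
have -> : n.+1%:R * nc (bcoef g n.+1) = nc (g + n%:R) * nc (bcoef g n).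
  by rewrite -[RHS]Normc.normcM -bcoefS [RHS]Normc.normcM normc_nat.
rewrite -natrM addnS -mul_bin_diag natrM /=; apply: ler_pM => //; try exact: normc_ge0.
by apply: le_trans (normcD _ _) _; rewrite normc_nat -addSn natrD lerD2r.
Qed.

(** Multiplication by 1 - x lowers m by one through Pascal's rule, up to a last term of favourable
    sign. *)
Lemma binomial_sum_le m (x : R) N : 0 <= x < 1 ->
  \sum_(n < N) 'C(m + n, n)%:R * x ^+ n <= (1 - x)^-1 ^+ m.+1.
Proof.
move=> x01; have /andP[x0 x1] := x01; have y0 : 0 < 1 - x by rewrite subr_gt0.
elim: m => [|m IH].
  by rewrite expr1; under eq_bigr do rewrite add0n binn mul1r; exact: geometric_sum_le.
rewrite exprSr ler_pdivlMr//; apply: le_trans IH.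
rewrite mulrBr mulr1 lerBlDr -lerBlDl.
case: N => [|N]; first by rewrite !big_ord0 subrr mul0r.
rewrite [X in X - _]big_ord_recl [X in _ - X]big_ord_recl /= !bin0.
rewrite opprD addrACA subrr add0r -sumrB.
apply: (@le_trans _ _ ((\sum_(i < N) 'C(m.+1 + i, i)%:R * x ^+ i) * x)).
  rewrite mulr_suml ler_sum// => i _; rewrite /bump /= add1n -mulrBl -mulrA -exprSr.
  by rewrite -natrB ?addSn ?binS ?addnS ?leq_addr// addKn.
rewrite ler_wpM2r// [leRHS]big_ord_recr lerDl mulr_ge0// exprn_ge0//.
Qed.

Lemma exists_nat_ge (x : R) : exists m : nat, x <= m.+1%:R.
Proof.
exists (Num.truncn `|x|); apply: le_trans (ler_norm _) _; apply: ltW.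
by have /andP[] := truncn_itv (normr_ge0 x).
Qed.

Lemma bcoef_sum_le g m (r : R) N : nc g <= m.+1%:R -> 0 <= r < 1 ->
  \sum_(n < N) nc (bcoef g n) * r ^+ n <= (1 - r)^-1 ^+ m.+1.
Proof.
move=> gm r01; apply: le_trans (binomial_sum_le m N r01).
by apply: ler_sum => n _; rewrite ler_wpM2r ?bcoef_le// exprn_ge0; case/andP: r01.
Qed.

Lemma bcoef_csum g z : nc z < 1 -> exists l, csum (fun n => bcoef g n * z ^+ n) l.
Proof.
move=> z1; have [m gm] := exists_nat_ge (nc g).
apply: (abs_csum (B := (1 - nc z)^-1 ^+ m.+1)) => N.
under eq_bigr do rewrite Normc.normcM normcX.
by apply: bcoef_sum_le; rewrite ?normc_ge0.
Qed.

(* (1 - x t) f'(x) = g t f(x) makes f(x) (1 - x t) ^ g constant on [0, 1]. *)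
Lemma binomial_series g t : nc t < 1 ->
  csum (fun n => bcoef g n * t ^+ n) (Cpow (1 - t) (- g)).
Proof.
move=> t1; have t0 := normc_ge0 t.
(* The derivative is needed up to x = 1 included, so K exceeds 1, yet [K * nc t < 1]. *)
pose K := 2 / (1 + nc t); have K0 : 0 < 1 + nc t by lra.
have K1 : 1 < K by rewrite ltr_pdivlMr//; lra.
have Kt (x : R) : `|x| <= K -> nc (x%:C * t) < 1.
  move=> xK; rewrite Normc.normcM normc_real; apply: le_lt_trans (ler_wpM2r t0 xK) _.
  by rewrite mulrAC ltr_pdivrMr//; lra.
pose c h n := bcoef h n * t ^+ n.
have cS h n : n.+1%:R * c h n.+1 = h * t * c (h + 1) n.
  by rewrite /c mulrA bcoef_shift exprS; ring.
have cS' h n : n.+1%:R * c h n.+1 = (h + n%:R) * t * c h n.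
  by rewrite /c mulrA bcoefS exprS; ring.
have csumc h (x : R) : `|x| <= K -> csum (fun n => c h n * x%:C ^+ n) (ray_sum (c h) x).
  move=> /Kt/(bcoef_csum h)[l hl].
  have hl' : csum (fun n => c h n * x%:C ^+ n) l.
    by apply: eq_csum hl => n; rewrite /c exprMn; ring.
  by rewrite (ray_sumE hl').
have csumc1 h (x : R) : `|x| <= K ->
    csum (fun n => n.+1%:R * c h n.+1 * x%:C ^+ n) (h * t * ray_sum (c (h + 1)) x).
  by move=> /(csumc (h + 1))/(csumZ (c := h * t)); apply: eq_csum => n; rewrite cS mulrA.
have csumc2 h (x : R) : `|x| <= K ->
    csum (fun n => n.+1%:R * (n.+2%:R * c h n.+2) * x%:C ^+ n)
      (h * t * ((h + 1) * t * ray_sum (c (h + 1 + 1)) x)).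
  move=> /(csumc1 (h + 1))/(csumZ (c := h * t)); apply: eq_csum => n.
  by rewrite !cS; rewrite [in RHS]mulrCA !cS; ring.
have KK : `|K| <= K by rewrite ger0_norm//; lra.
set f := ray_sum (c g).
have df x : 0 <= x <= 1 -> cderiv f x (g * t * ray_sum (c (g + 1)) x).
  move=> /andP[x0 x1].
  have xK : `|x| <= K by rewrite ger0_norm//; lra.
  rewrite -(ray_sumE (csumc1 g x xK)).
  apply: (cderiv_ray_sum (csumc g K KK) (csumc1 g K KK) (csumc2 g K KK)).
  by rewrite !ger0_norm//; lra.
(* With D the derivative of f at x, summing the recurrence [cS'] gives D = g t f + x t D. *)
have ode x : 0 <= x <= 1 ->
    (1 - x%:C * t) * (g * t * ray_sum (c (g + 1)) x) = g * t * f x.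
  move=> /andP[x0 x1].
  have xK : `|x| <= K by rewrite ger0_norm//; lra.
  set D := g * t * _.
  have h1 : csum (fun n => n%:R * c g n * x%:C ^+ n) (x%:C * D).
    have := csum_cons (a := fun n => n%:R * c g n * x%:C ^+ n) (l := x%:C * D).
    rewrite !mul0r add0r; apply; apply: eq_csum (csumZ (c := x%:C) (csumc1 g x xK)) => n.
    by rewrite exprS; ring.
  have h2 := csumD (csumZ (c := g * t) (csumc g x xK)) (csumZ (c := t) h1).
  rewrite -/f in h2.
  have DE : D = g * t * f x + t * (x%:C * D).
    apply: csum_uniq (csumc1 g x xK) _.
    by apply: eq_csum h2 => n; rewrite cS' ; ring.
  by rewrite -[RHS](addrK (t * (x%:C * D))) -DE; ring.
have pos (x : R) : 0 <= x <= 1 -> 0 < 1 - x * complex.Re t.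
  move=> /andP[x0 x1]; rewrite subr_gt0; apply: le_lt_trans (ler_norm _) _.
  rewrite normrM ger0_norm//; apply: le_lt_trans (_ : nc t < 1) => //.
  apply: le_trans (ler_Re_normc t).
  by rewrite ler_piMl.
have dP x : 0 <= x <= 1 -> cderiv (fun y => f y * Cexp (g * log_ray t y)) x 0.
  move=> x01; have dl := cderivM (cderiv_cst g x) (cderiv_log_ray (pos x x01)).
  have := cderivM (df x x01) (cderiv_Cexp dl).
  rewrite mul0r add0r (_ : _ + _ = 0)//.
  have nz : 1 - x%:C * t != 0.
    apply/eqP => /(congr1 (@complex.Re R)); case: (t) (pos x x01) => a b /=.
    by rewrite mul0r subr0 => /gt_eqF/eqP.
  apply: (mulfI nz); rewrite mulr0 mulrDr !mulrA.
  have := ode x x01; rewrite !mulrA => ->; field.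
  exact: nz.
have := cderiv0_eq dP.
have -> : log_ray t 0 = 0.
  by rewrite /log_ray !mul0r subr0 oppr0 mul0r expr1n expr0n addr0 ln1 mul0r atan0.
have -> : f 0 = 1.
  apply: ray_sumE; have := @csum_finite R (fun n => c g n * 0%:C ^+ n) 1.
  rewrite big_ord1 expr0 mulr1 /c bcoef0 mulr1; apply.
  by case=> // n _; rewrite rmorph0 expr0n /= mulr0.
rewrite mulr0 Cexp0 mulr1 -Clog_ray; last by apply: pos; rewrite ler01 lexx.
rewrite rmorph1 mul1r => f1.
have -> : Cpow (1 - t) (- g) = f 1.
  rewrite /Cpow mulNr; apply: (mulIf (Cexp_neq0 (g * Clog (1 - t)))).
  by rewrite CexpN f1.
have := csumc g 1; rewrite normr1 => /(_ (ltW K1)); apply: eq_csum => n.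
by rewrite rmorph1 expr1n mulr1.
Qed.

End Binomial.

(** * Growth of the extended beta functions *)

Section IntegralBound.
Context d (T : measurableType d) (R : realType) (mu : {measure set T -> \bar R}).
Implicit Types (D : set T) (f phi : T -> R).

Local Open Scope ereal_scope.

(* The integral of a nonnegative function is a supremum over the simple functions
   below it. *)
Lemma ge0_le_integral_sup D (f1 f2 : T -> \bar R) :
  (forall x, D x -> 0 <= f1 x) -> (forall x, D x -> f1 x <= f2 x) ->
  \int[mu]_(x in D) f1 x <= \int[mu]_(x in D) f2 x.
Proof.
move=> f10 f12; have f20 x : D x -> 0 <= f2 x.
  by move=> Dx; apply: le_trans (f10 x Dx) (f12 x Dx).
rewrite !ge0_integralE//; apply: le_ereal_sup => _ [h hf <-].
exists h => // x; apply: le_trans (hf x) _; rewrite /patch.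
by case: ifPn => // /[!inE] /f12.
Qed.

(* When one of the two parts of [phi ^+ k * f] has infinite integral, the
   integral is infinite and [fine] sends it to 0. *)
Lemma Rintegral_powM_bounded D phi f : (forall x, D x -> (0 <= phi x <= 1)%R) ->
  exists M : R, forall k, (`|\int[mu]_(x in D) (phi x ^+ k * f x)| <= M)%R.
Proof.
move=> phi01.
pose G k (x : T) : \bar R := (phi x ^+ k * f x)%:E.
pose P k := \int[mu]_(x in D) (G k)^\+ x.
pose N k := \int[mu]_(x in D) (G k)^\- x.
have IE k : (\int[mu]_(x in D) (phi x ^+ k * f x) = fine (P k - N k))%R.
  by rewrite /Rintegral integralE.
have P0 k : 0 <= P k by apply: integral_ge0 => x _; exact: funepos_ge0.
have N0 k : 0 <= N k by apply: integral_ge0 => x _; exact: funeneg_ge0.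
have phiX x k : D x -> (0 <= phi x ^+ k <= 1)%R.
  by move=> /phi01/andP[p0 p1]; rewrite exprn_ge0//= exprn_ile1.
have GS k j x : D x -> exists2 c : R, (0 <= c <= 1)%R &
    (phi x ^+ (k + j) * f x = c * (phi x ^+ k * f x))%R.
  by move=> Dx; exists (phi x ^+ j)%R; [exact: phiX|rewrite exprD; ring].
(* As [phi] takes values in [0, 1], neither the positive nor the negative part increases with the
   exponent. *)
have PS k j : P (k + j)%N <= P k.
  apply: ge0_le_integral_sup => x Dx; first exact: funepos_ge0.
  rewrite !funeposE /G -!EFin_max lee_fin.
  have [c /andP[c0 c1] ->] := GS k j x Dx; move: (phi x ^+ k * f x)%R => y.
  have [y0|y0] := leP 0%R y.
    by rewrite (max_idPl (mulr_ge0 c0 y0)) ler_piMl.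
  by rewrite ge_max lexx andbT mulr_ge0_le0// ltW.
have NS k j : N (k + j)%N <= N k.
  apply: ge0_le_integral_sup => x Dx; first exact: funeneg_ge0.
  rewrite !funenegE /G -!EFinN -!EFin_max lee_fin.
  have [c /andP[c0 c1] ->] := GS k j x Dx; move: (phi x ^+ k * f x)%R => y.
  have [y0|y0] := leP 0%R y.
    by rewrite (max_idPr _) ?le_max ?lexx ?orbT// oppr_le0 mulr_ge0.
  rewrite -mulrN (max_idPl _) ?mulr_ge0 ?oppr_ge0 ?(ltW y0)//.
  by rewrite le_max ler_piMl// oppr_ge0 ltW.
(* Either both parts are finite at some k0, hence bounded from k0 on, and the finitely many earlier
   values are added to the bound; or every [P k - N k] is infinite and [fine] returns 0. *)
have [[k0 [Pk Nk]]|H] := pselect (exists k, P k < +oo /\ N k < +oo); last first.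
  exists 0%R => k; rewrite IE normr_le0; apply/eqP.
  have := P0 k; have := N0 k.
  case Ek : (P k) => [r| |] //; case En : (N k) => [s| |] //.
  by case: H; exists k; rewrite Ek En !ltry.
have [p pE] : exists p : R, P k0 = p%:E.
  by move: (P0 k0) Pk; case: (P k0) => [r| |]// _ _; exists r.
have [n nE] : exists n : R, N k0 = n%:E.
  by move: (N0 k0) Nk; case: (N k0) => [r| |]// _ _; exists r.
have S0 : (0 <= \sum_(i < k0) `|fine (P i - N i)|)%R by exact: sumr_ge0.
have p0 : (0 <= p)%R by rewrite -lee_fin -pE.
have n0 : (0 <= n)%R by rewrite -lee_fin -nE.
exists (\sum_(i < k0) `|fine (P i - N i)| + p + n)%R => k; rewrite IE.
have [kk|kk] := ltnP k k0.
  rewrite (bigD1 (Ordinal kk))//= -!addrA lerDl !addr_ge0//; exact: sumr_ge0.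
have := PS k0 (k - k0)%N; have := NS k0 (k - k0)%N; rewrite subnKC// pE nE.
have := P0 k; have := N0 k.
case: (P k) => [r| |] //; case: (N k) => [s| |] //.
rewrite !lee_fin /= => s0 r0 sn rp; rewrite ler_norml.
by apply/andP; split; lra.
Qed.

End IntegralBound.

(** * Boundedness in k and subexponential growth *)

Section ExtendedBeta.
Variable R : realType.
Implicit Types (x y a sg : R[i]).

Lemma Cpow_realD (u : R) x k : 0 < u -> Cpow u%:C (x + k%:R) = (u ^+ k)%:C * Cpow u%:C x.
Proof.
move=> u0; rewrite /Cpow mulrDl CexpD CexpMn mulrC; congr (_ * _).
rewrite rmorphXn /=; congr (_ ^+ _); rewrite Clog_real//.
by rewrite /Cexp /= lnK// cos0 sin0 mulr1.
Qed.

Lemma eq_Cintegral (D : set R) (f h : R -> R[i]) : {in D, f =1 h} ->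
  Cintegral D f = Cintegral D h.
Proof.
move=> fh; rewrite /Cintegral; congr (_ +i* _).
  by apply: eq_Rintegral => u /fh ->.
by apply: eq_Rintegral => u /fh ->.
Qed.

Lemma Cintegral_powM_bounded (f : R -> R[i]) : exists M : R, forall k,
  nc (Cintegral `]0, 1[ (fun u => (u ^+ k)%:C * f u)) <= M.
Proof.
have u01 (u : R) : `]0, 1[%classic u -> 0 <= u <= 1.
  by rewrite /= in_itv /= => /andP[u0 u1]; rewrite !ltW.
have [M1 H1] := Rintegral_powM_bounded lebesgue_measure
  (fun u => complex.Re (f u)) u01.
have [M2 H2] := Rintegral_powM_bounded lebesgue_measure
  (fun u => complex.Im (f u)) u01.
exists (M1 + M2) => k; apply: le_trans (normc_le_ReIm _) _.
apply: lerD.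
  apply: le_trans (H1 k); rewrite le_eqVlt; apply/orP; left; apply/eqP.
  congr (`| _ |); apply: eq_Rintegral => u _.
  by case: (f u) => ? ? /=; rewrite mul0r subr0.
apply: le_trans (H2 k); rewrite le_eqVlt; apply/orP; left; apply/eqP.
congr (`| _ |); apply: eq_Rintegral => u _.
by case: (f u) => ? ? /=; rewrite mul0r addr0.
Qed.

(** The shift by k only multiplies the integrand by u^k, with u in ]0, 1[. *)
Lemma extBeta_bounded x y (p lam : R) :
  exists M : R, forall k : nat, nc (extBeta (x + k%:R) y p lam) <= M.
Proof.
have [M HM] := Cintegral_powM_bounded (fun u : R =>
  Cpow u%:C (x - 1) * Cpow (1 - u)%:C (y - 1) *
  (MittagLeffler lam (- (p / (u * (1 - u)))))%:C).
exists M => k; apply: le_trans (HM k); rewrite /extBeta le_eqVlt; apply/orP; left.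
apply/eqP; congr nc; apply: eq_Cintegral => u.
rewrite inE /= in_itv /= => /andP[u0 _].
by rewrite addrAC Cpow_realD// !mulrA.
Qed.

(** Equivalently, the power series with coefficients [c] has radius of convergence at least 1. *)
Definition subexponential (c : nat -> R[i]) := forall rho : R, 0 < rho < 1 ->
  exists D : R, forall k, nc (c k) * rho ^+ k <= D.

(** From K on the modulus is at least 1; the finitely many other inverses are bounded by their
    sum. *)
Lemma normc_shift_invr_bounded a : (forall m : nat, a != - m%:R) ->
  exists B : R, forall k : nat, (nc (k%:R + a))^-1 <= B.
Proof.
move=> ha; pose K := (Num.truncn (nc a)).+2.
have Ka : nc a + 1 <= K%:R.
  have /andP[_] := truncn_itv (normc_ge0 a); rewrite /K => /ltW h.
  by rewrite -[X in _ <= X]natr1 lerD2r.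
have nn k : 0 <= (nc (k%:R + a))^-1 by rewrite invr_ge0 normc_ge0.
have S0 : 0 <= \sum_(k < K) (nc (k%:R + a))^-1 by exact: sumr_ge0.
exists (\sum_(k < K) (nc (k%:R + a))^-1 + 1) => k; have [kK|Kk] := ltnP k K.
  by rewrite (bigD1 (Ordinal kK))//= -addrA lerDl addr_ge0// sumr_ge0.
have k1 : 1 <= nc (k%:R + a).
  have := normcB (k%:R + a) a; rewrite addrK normc_nat.
  have : K%:R <= k%:R :> R by rewrite ler_nat.
  by lra.
apply: ler_wpDl => //; rewrite invf_le1//; exact: lt_le_trans k1.
Qed.

(** The logarithm of [nc (k%:R + a)] is at most eps k + C in absolute value, and eps is taken so
    small that [rho ^+ k] absorbs the resulting exponential. *)
Lemma subexponential_CpowV a sg : (forall m : nat, a != - m%:R) ->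
  subexponential (fun k => (Cpow (k%:R + a) sg)^-1).
Proof.
move=> ha rho /andP[rho0 rho1].
have [B HB] := normc_shift_invr_bounded ha.
set s := `|complex.Re sg|; have s0 : 0 <= s by exact: normr_ge0.
(* Chosen so that [s * eps <= - ln rho]; adding 1 avoids a division by 0. *)
pose eps := - ln rho / (s + 1).
have s1 : 0 < s + 1 by rewrite ltr_wpDl.
have lr : 0 < - ln rho by rewrite oppr_gt0 ln_lt0// rho0.
have eps0 : 0 < eps by rewrite divr_gt0.
pose C := `|B| + (eps * nc a + `|ln eps|).
have logle k : `|ln (nc (k%:R + a))| <= eps * k%:R + C.
  have r0 : 0 < nc (k%:R + a).
    rewrite normc_gt0; apply/eqP => h; have /eqP := ha k; apply.
    by apply/eqP; rewrite -addr_eq0 addrC; apply/eqP.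
  have f1 : 0 <= eps * nc a by apply: mulr_ge0 (ltW eps0) (normc_ge0 _).
  have f2 : 0 <= eps * k%:R by apply: mulr_ge0 (ltW eps0) (ler0n _ _).
  rewrite ler_norml; apply/andP; split.
    (* For a modulus r, - ln r is the logarithm of 1/r, hence below 1/r, which B bounds. *)
    rewrite lerNl -lnV ?posrE//; apply: le_trans (ltW (ln_sublinear _)) _;
      first by rewrite invr_gt0.
    apply: le_trans (HB k) _; have := ler_norm B; have := normr_ge0 (ln eps).
    by rewrite /C; lra.
  have e1 : ln (eps * nc (k%:R + a)) < eps * nc (k%:R + a).
    by apply: ln_sublinear; rewrite mulr_gt0.
  rewrite lnM ?posrE// in e1.
  have e2 : eps * nc (k%:R + a) <= eps * k%:R + eps * nc a.
    rewrite -mulrDr ler_wpM2l ?(ltW eps0)//; apply: le_trans (normcD _ _) _.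
    by rewrite normc_nat.
  have e3 := ler_norm (- ln eps); rewrite normrN in e3.
  have := normr_ge0 B; rewrite /C; lra.
exists (expR (s * C + `|complex.Im sg| * pi)) => k.
apply: le_trans (ler_wpM2r _ (normc_CpowV_le _ _)) _; first by rewrite exprn_ge0// ltW.
rewrite -[X in X ^+ k](lnK (x := rho)) ?posrE// -expRM_natl -expRD ler_expR -/s.
have h1 : s * `|ln (nc (k%:R + a))| <= s * (eps * k%:R + C) by rewrite ler_wpM2l.
have h2 : s * eps <= - ln rho.
  by rewrite /eps mulrA ler_pdivrMr// mulrC ler_wpM2l ?(ltW lr)// lerDl.
have h3 : s * eps * k%:R <= - ln rho * k%:R by rewrite ler_wpM2r.
rewrite mulrDr mulrA in h1; rewrite mulNr in h3.
rewrite [k%:R * _]mulrC; move: h1 h3.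
move: (ln rho * _) (s * eps * _) (s * C) (s * `|_|) (_ * pi) => x1 x2 x3 x4 x5 *.
by lra.
Qed.

End ExtendedBeta.

(** * The generating function *)

Section BinomialContinuity.
Variable R : realType.
Implicit Types (g t x y : R[i]).

Lemma Re_one_sub_gt0 t : nc t < 1 -> 0 < complex.Re (1 - t).
Proof.
move=> t1; have := le_lt_trans (Re_le_normc t) t1.
by case: t {t1} => a b /= a1; rewrite subr_gt0.
Qed.

Lemma one_sub_neq0 t : nc t < 1 -> 1 - t != 0.
Proof. by move=> /Re_one_sub_gt0 h; apply: contraTneq h => ->; rewrite ltxx. Qed.

(** Since 1 - (t + h) = (1 - t)(1 - h / (1 - t)), the binomial series gives an expansion in h. *)
Lemma Cpow_one_sub_lipschitz g t : nc t < 1 -> exists C rho : R, 0 < rho /\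
  forall h, nc h < rho ->
    nc (Cpow (1 - (t + h)) (- g) - Cpow (1 - t) (- g)) <= C * nc h.
Proof.
move=> t1; have nz := one_sub_neq0 t1; have n0 : 0 < nc (1 - t) by rewrite normc_gt0.
pose rho := nc (1 - t) / 2; have rho0 : 0 < rho by rewrite divr_gt0.
pose c n := Cpow (1 - t) (- g) * bcoef g n / (1 - t) ^+ n.
have cP h : nc h <= rho -> csum (fun n => c n * h ^+ n) (Cpow (1 - (t + h)) (- g)).
  move=> hr; set k := h / (1 - t).
  have k1 : nc k < 1.
    by rewrite Normc.normcM Normc.normcV ltr_pdivrMr// mul1r; move: hr; rewrite /rho; lra.
  rewrite (_ : 1 - (t + h) = (1 - t) * (1 - k)); last by rewrite /k; field.
  rewrite CpowM ?Re_one_sub_gt0//.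
  have H := csumZ (c := Cpow (1 - t) (- g)) (binomial_series (g := g) k1).
  by apply: eq_csum H => n; rewrite /c /k expr_div_n; ring.
have [|M HM] := csum_bounded (cP rho%:C _); first by rewrite normc_real gtr0_norm.
apply: (analytic_at_lipschitz (H := fun s => Cpow (1 - s) (- g))).
exists c, rho, M; split=> // [n|h hr]; last by apply: cP; exact: ltW.
by have := HM n; rewrite Normc.normcM normcX normc_real gtr0_norm.
Qed.

Lemma exists_pos_lt (a b c : R) : 0 < a -> 0 < b -> 0 < c ->
  exists x : R, [/\ 0 < x, x < a, x < b & x < c].
Proof.
move=> a0 b0 c0; pose m := Num.min a (Num.min b c).
have m0 : 0 < m by rewrite !lt_min a0 b0.
have m2 : m / 2 < m by lra.
have : m <= m by []; rewrite {2}/m !le_min => /andP[ma /andP[mb mc]].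
by exists (m / 2); split; first lra; exact: lt_le_trans m2 _.
Qed.

Lemma eq_normc_small x y : (forall e : R, 0 < e -> nc (x - y) <= e) -> x = y.
Proof.
move=> h; apply/eqP; rewrite -subr_eq0 -normc_eq0 eq_le normc_ge0 andbT.
by apply/ler_addgt0Pr => e e0; rewrite add0r h.
Qed.

Lemma mul_normc_close (x y x0 y0 : R[i]) (e : R) : e <= 1 ->
  nc (x - x0) < e -> nc (y - y0) < e ->
  nc (x * y - x0 * y0) <= (nc x0 + 1) * e + e * nc y0.
Proof.
move=> e1 hx hy; have x1 : nc x <= nc x0 + 1.
  by have := normcD (x - x0) x0; rewrite subrK; lra.
have -> : x * y - x0 * y0 = x * (y - y0) + (x - x0) * y0 by ring.
apply: le_trans (normcD _ _) _; rewrite !Normc.normcM; apply: lerD.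
  by apply: ler_pM; rewrite ?normc_ge0// ltW.
by rewrite ler_wpM2r ?normc_ge0// ltW.
Qed.

(* Moving left from y is nontangential to the circle |x| = |y|. *)
Lemma stolz_left y (eta p Q : R) : 0 < p -> p <= complex.Re y -> nc y <= Q ->
  0 < eta <= complex.Re y -> let x := 1 - eta%:C / y in
  [/\ nc x < 1, nc (1 - x) <= 2 * Q / p * (1 - nc x), nc (1 - x) <= eta / p &
      x * y = y - eta%:C].
Proof.
move=> p0 py yQ /andP[e0 ey] x.
have Ry : 0 < complex.Re y by exact: lt_le_trans py.
have ny : 0 < nc y by apply: lt_le_trans Ry (Re_le_normc y).
have y0 : y != 0 by rewrite -normc_gt0.
have xy : x * y = y - eta%:C by rewrite /x; field.
have x1E : nc (1 - x) = eta / nc y.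
  by rewrite /x opprB addrC subrK Normc.normcM Normc.normcV normc_real gtr0_norm.
have nxE : nc x = nc (y - eta%:C) / nc y by rewrite -xy Normc.normcM mulfK// gt_eqF.
have sq : nc (y - eta%:C) ^+ 2 = nc y ^+ 2 - (2 * eta * complex.Re y - eta ^+ 2).
  by rewrite !normc_sqr; case: (y) => a b /=; ring.
have w0 := normc_ge0 (y - eta%:C).
rewrite x1E nxE; move: (nc (y - _)) sq w0 => w sq w0.
(* |y|^2 - |y - eta|^2 = 2 eta Re y - eta^2, which is at least eta Re y because eta <= Re y. *)
have gap : eta * complex.Re y <= (nc y - w) * (nc y + w).
  have -> : (nc y - w) * (nc y + w) = 2 * eta * complex.Re y - eta ^+ 2.
    by rewrite -subr_sqr sq; ring.
  by rewrite -subr_ge0 (_ : _ - _ = eta * (complex.Re y - eta));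
    [rewrite mulr_ge0 ?subr_ge0// ltW|ring].
have gap0 : 0 < (nc y - w) * (nc y + w) by apply: lt_le_trans gap; rewrite mulr_gt0.
have wy : w < nc y by move: gap0; rewrite pmulr_lgt0 ?subr_gt0// ltr_wpDr.
split=> //.
- by rewrite ltr_pdivrMr// mul1r.
- have -> : 2 * Q / p * (1 - w / nc y) = (2 * Q * (nc y - w) / p) / nc y.
    by field; rewrite !gt_eqF.
  rewrite ler_pM2r ?invr_gt0// ler_pdivlMr//.
  apply: le_trans (_ : eta * complex.Re y <= _); first by rewrite ler_pM2l.
  apply: le_trans gap _; rewrite mulrC ler_pM2r ?subr_gt0//.
  by lra.
- rewrite ler_pM2l// lef_pV2 ?posrE//; apply: le_trans py (Re_le_normc y).
Qed.

End BinomialContinuity.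

(** * Generating series built on a subexponential sequence *)

Section GeneratingFunction.
Variable R : realType.
Variable d : nat -> R[i].
Hypothesis d_subexp : subexponential d.
Implicit Types (g z t s w : R[i]).

Definition lerch_coef g k := bcoef g k * d k.

(* The Hurwitz-Lerch series with an arbitrary subexponential sequence d in place
   of B(th + k, up - th; p, lam) / (B(th, up - th) (k + a) ^ sg). *)
Definition lerch g z : R[i] :=
  limn (series (fun k => lerch_coef g k * z ^+ k : R[i]^o)).

(** [rho] lies strictly between q and 1, and the bound at [rho] leaves a geometric factor of ratio q
    / rho. *)
Lemma subexponential_geometric (q : R) : 0 <= q < 1 -> exists D r : R,
  [/\ 0 <= D, 0 <= r < 1 & forall k, nc (d k) * q ^+ k <= D * r ^+ k].
Proof.
move=> /andP[q0 q1]; pose rho := (1 + q) / 2.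
have rho0 : 0 < rho by rewrite /rho; lra.
have [|D HD] := d_subexp (rho := rho); first by rewrite rho0 /rho /=; lra.
exists D, (q / rho); split.
- by apply: le_trans (HD 0%N); rewrite mulr_ge0 ?normc_ge0.
- by rewrite divr_ge0 ?(ltW rho0)//= ltr_pdivrMr// mul1r /rho; lra.
- move=> k; have q0' : 0 <= (q / rho) ^+ k by rewrite exprn_ge0// divr_ge0// ltW.
  apply: le_trans (ler_wpM2r q0' (HD k)).
  by rewrite -mulrA -exprMn mulrCA divff ?gt_eqF// mulr1.
Qed.

Lemma normc_lerch_term g z k :
  nc (lerch_coef g k * z ^+ k) = nc (bcoef g k) * (nc (d k) * nc z ^+ k).
Proof.
by rewrite /lerch_coef -mulrA Normc.normcM [nc (d k * _)]Normc.normcM normcX.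
Qed.

Lemma lerch_csum g z : nc z < 1 ->
  csum (fun k => lerch_coef g k * z ^+ k) (lerch g z).
Proof.
move=> z1; have [m gm] := exists_nat_ge (nc g).
have [|D [r [D0 r01 HD]]] := @subexponential_geometric (nc z).
  by rewrite normc_ge0.
have [l hl] : exists l, csum (fun k => lerch_coef g k * z ^+ k) l.
  apply: (abs_csum (B := D * (1 - r)^-1 ^+ m.+1)) => N.
  apply: le_trans (ler_wpM2l D0 (bcoef_sum_le N gm r01)).
  rewrite mulr_sumr; apply: ler_sum => k _.
  by rewrite normc_lerch_term [leRHS]mulrCA ler_wpM2l ?normc_ge0.
by rewrite /lerch (csum_lim hl).
Qed.

Definition gen_coef g z n := bcoef g n * lerch (g + n%:R) z.

(** The right-hand side F, whereas [gen_coef g z] gives the coefficients of the series G on the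
    left. *)
Definition gen_sum g z t := Cpow (1 - t) (- g) * lerch g (z / (1 - t)).

Lemma nat_shift_le g m k : nc g <= m.+1%:R -> nc (g + k%:R) <= (m + k).+1%:R.
Proof.
by move=> gm; apply: le_trans (normcD _ _) _; rewrite normc_nat -addSn natrD lerD2r.
Qed.

(* (g)_n (g + n)_k = (g)_(n + k) = (g)_k (g + k)_n, and the inner sum over n is
   the binomial series of (1 - t) ^ (- g - k). *)
Lemma gen_series g z t : nc z + nc t < 1 ->
  csum (fun n => gen_coef g z n * t ^+ n) (gen_sum g z t).
Proof.
move=> zt; have z0 := normc_ge0 z; have t0 := normc_ge0 t.
have t1 : nc t < 1 by lra.
have z1 : nc z < 1 by lra.
have t1' : 0 < 1 - nc t by rewrite subr_gt0.
have [m gm] := exists_nat_ge (nc g).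
(* Summing over n costs a factor (1 - |t|)^(-(m + k + 1)), so |z| / (1 - |t|) < 1 is the ratio that
   governs the sum over k. *)
have [|D [r [D0 r01 HD]]] := @subexponential_geometric (nc z / (1 - nc t)).
  by rewrite divr_ge0 ?(ltW t1')//= ltr_pdivrMr// mul1r; lra.
pose A k n := lerch_coef g k * z ^+ k * (bcoef (g + k%:R) n * t ^+ n).
set u := (1 - nc t)^-1; have u0 : 0 < u by rewrite invr_gt0.
pose rr k := u ^+ m.+1 * D * ('C(m + k, k)%:R * r ^+ k).
have rows k N : \sum_(n < N) nc (A k n) <= rr k.
  have tt : 0 <= nc t < 1 by rewrite t0.
  have h := bcoef_sum_le N (nat_shift_le k gm) tt; rewrite -/u in h.
  apply: (@le_trans _ _ (nc (lerch_coef g k * z ^+ k) * u ^+ (m + k).+1)).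
    apply: le_trans (ler_wpM2l (normc_ge0 _) h); rewrite mulr_sumr.
    by apply: ler_sum => n _; rewrite /A Normc.normcM [nc (_ * t ^+ n)]Normc.normcM normcX.
  have := HD k; rewrite expr_div_n -exprVn -/u => HDk.
  have h2 : nc (bcoef g k) * (nc (d k) * (nc z ^+ k * u ^+ k)) <=
      'C(m + k, k)%:R * (D * r ^+ k).
    apply: ler_pM; rewrite ?normc_ge0 ?bcoef_le//.
    by rewrite !mulr_ge0 ?normc_ge0 ?exprn_ge0 ?(ltW u0).
  have := ler_wpM2l (exprn_ge0 m.+1 (ltW u0)) h2.
  rewrite /rr normc_lerch_term -addSn exprD => h3.
  by apply: le_trans (le_trans _ h3) _; rewrite le_eqVlt; apply/orP; left; apply/eqP; ring.
have rsum K : \sum_(k < K) rr k <= u ^+ m.+1 * D * (1 - r)^-1 ^+ m.+1.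
  rewrite -mulr_sumr ler_wpM2l ?binomial_sum_le// mulr_ge0// exprn_ge0//.
  exact: ltW.
have [row [col [l [rowP colP rowl coll]]]] := fubini_csum rows rsum.
have nz := one_sub_neq0 t1.
have rowE k : row k = Cpow (1 - t) (- g) * (lerch_coef g k * (z / (1 - t)) ^+ k).
  apply: csum_uniq (rowP k) _; have h := binomial_series (g := g + k%:R) t1.
  rewrite (CpowBn _ _ (Re_one_sub_gt0 t1)) in h.
  rewrite expr_div_n (_ : _ * _ = lerch_coef g k * z ^+ k *
    (Cpow (1 - t) (- g) / (1 - t) ^+ k)); last by ring.
  exact: csumZ h.
have colE n : col n = gen_coef g z n * t ^+ n.
  apply: csum_uniq (colP n) _.
  have h := csumZ (c := bcoef g n * t ^+ n) (lerch_csum (g := g + n%:R) z1).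
  rewrite /gen_coef mulrAC; apply: eq_csum h => k; rewrite /A /lerch_coef.
  transitivity (bcoef g n * bcoef (g + n%:R) k * (d k * z ^+ k * t ^+ n)); first by ring.
  transitivity (bcoef g k * bcoef (g + k%:R) n * (d k * z ^+ k * t ^+ n)); last by ring.
  by rewrite !bcoefM addnC [_%:R * n`!%:R]mulrC.
have w1 : nc (z / (1 - t)) < 1.
  rewrite Normc.normcM Normc.normcV ltr_pdivrMr ?normc_gt0// mul1r.
  by have := normcB (1 - t) (- t); rewrite opprK subrK Normc.normc1 normc_opp; lra.
have -> : gen_sum g z t = l.
  apply: csum_uniq (csumZ (c := Cpow (1 - t) (- g)) (lerch_csum (g := g) w1)) _.
  by apply: eq_csum rowl => k; rewrite rowE.
by apply: eq_csum coll => n; rewrite colE.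
Qed.

(* The generating identity at (z / (1 - s), h / (1 - s)) is the Taylor expansion
   at s. *)
Lemma gen_sum_analytic g z s : nc s < 1 -> nc z < nc (1 - s) ->
  analytic_at (gen_sum g z) s.
Proof.
move=> s1 zs; have nz := one_sub_neq0 s1; have n0 : 0 < nc (1 - s) by rewrite normc_gt0.
set w := z / (1 - s).
have w1 : nc w < 1 by rewrite Normc.normcM Normc.normcV ltr_pdivrMr// mul1r.
(* The half keeps the closed disc in range, so that the coefficient bound can be read at
   [h = rho]. *)
pose rho := (1 - nc w) * nc (1 - s) / 2.
have rho0 : 0 < rho by rewrite divr_gt0// mulr_gt0// subr_gt0.
have hsmall h : nc h <= rho -> nc w + nc (h / (1 - s)) < 1.
  move=> hr; have : nc (h / (1 - s)) <= (1 - nc w) / 2.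
    by rewrite Normc.normcM Normc.normcV ler_pdivrMr// mulrAC.
  by lra.
pose c n := Cpow (1 - s) (- g) * gen_coef g w n / (1 - s) ^+ n.
have cP h : nc h <= rho -> csum (fun n => c n * h ^+ n) (gen_sum g z (s + h)).
  move=> /hsmall hr; set k := h / (1 - s) in hr.
  have k1 : nc k < 1 by have := normc_ge0 w; lra.
  have nk := one_sub_neq0 k1.
  have -> : gen_sum g z (s + h) = Cpow (1 - s) (- g) * gen_sum g w k.
    rewrite /gen_sum (_ : 1 - (s + h) = (1 - s) * (1 - k)); last by rewrite /k; field.
    rewrite CpowM ?Re_one_sub_gt0// -mulrA; congr (_ * (_ * lerch _ _)).
    by rewrite /w invfM mulrA.
  apply: eq_csum (csumZ (c := Cpow (1 - s) (- g)) (gen_series (g := g) hr)) => n.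
  by rewrite /c /k expr_div_n; ring.
have [|M HM] := csum_bounded (cP rho%:C _); first by rewrite normc_real gtr0_norm.
exists c, rho, M; split=> // [n|h hr]; last by apply: cP; exact: ltW.
by have := HM n; rewrite Normc.normcM normcX normc_real gtr0_norm.
Qed.

Lemma gen_sum_lipschitz g z s : nc s < 1 -> nc z < nc (1 - s) ->
  exists C rho : R, 0 < rho /\ forall h, nc h < rho ->
    nc (gen_sum g z (s + h) - gen_sum g z s) <= C * nc h.
Proof. by move=> s1 zs; exact: analytic_at_lipschitz (gen_sum_analytic g s1 zs). Qed.

(** * Continuation of F = G from 0 and passage to the limit at t *)

Section Continuation.
Variables (g z t S : R[i]).
Hypotheses (z1 : nc z < 1) (t1 : nc t < 1) (t0 : t != 0).
Hypothesis St : csum (fun n => gen_coef g z n * t ^+ n) S.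

Let G x := limn (series (fun n => gen_coef g z n * x ^+ n : R[i]^o)).

Let nt0 : 0 < nc t.
Proof. by rewrite normc_gt0. Qed.

Lemma gen_coef_bounded : exists M : R, forall n, nc (gen_coef g z n) * nc t ^+ n <= M.
Proof.
by have [M HM] := csum_bounded St; exists M => n; rewrite -normcX -Normc.normcM.
Qed.

Let GP x : nc x < nc t -> csum (fun n => gen_coef g z n * x ^+ n) (G x).
Proof.
move=> xt; have [M HM] := gen_coef_bounded.
by have [l hl] := power_csum nt0 xt HM; rewrite /G (csum_lim hl).
Qed.

Lemma gen_zero_near0 : zero_near (fun x => gen_sum g z x - G x) 0.
Proof.
exists (Num.min (1 - nc z) (nc t)); first by rewrite lt_min subr_gt0 z1.
move=> h; rewrite lt_min add0r => /andP[hz ht].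
have hz' : nc z + nc h < 1 by lra.
by rewrite (csum_uniq (gen_series (g := g) hz') (GP ht)) subrr.
Qed.

(** The two conditions place the segment in the disc of G and in the domain of F. *)
Lemma gen_zero_segment (b v : R[i]) :
  (forall x : R, 0 <= x <= 1 ->
    nc (b + x%:C * v) < nc t /\ nc z < nc (1 - (b + x%:C * v))) ->
  zero_near (fun x => gen_sum g z x - G x) b ->
  zero_near (fun x => gen_sum g z x - G x) (b + v).
Proof.
move=> bv; apply: zero_near_continuation => x /bv[xt zx].
apply: analytic_atB; first by apply: gen_sum_analytic => //; exact: lt_trans t1.
have [M HM] := gen_coef_bounded.
exact: power_series_analytic xt HM GP.
Qed.

Lemma zero_near_eq x : zero_near (fun x => gen_sum g z x - G x) x -> gen_sum g z x = G x.
Proof.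
move=> [rho r0 /(_ 0)]; rewrite Normc.normc0 addr0 => /(_ r0)/eqP.
by rewrite subr_eq0 => /eqP.
Qed.

(** With Re t <= 0 the ray from 0 to t stays at distance at least 1 from the point 1, hence more
    than [nc z]. *)
Lemma gen_eq_left : complex.Re t <= 0 -> forall x : R, 0 <= x < 1 ->
  gen_sum g z (x%:C * t) = G (x%:C * t).
Proof.
move=> rt x /andP[x0 x1]; apply: zero_near_eq.
have := @gen_zero_segment 0 (x%:C * t); rewrite add0r; apply; last exact: gen_zero_near0.
move=> y /andP[y0 y1]; rewrite add0r mulrA -rmorphM /=.
have yx0 : 0 <= y * x by rewrite mulr_ge0.
have yx1 : y * x < 1 by apply: le_lt_trans x1; rewrite ler_piMl.
split.
  by rewrite Normc.normcM normc_real ger0_norm// gtr_pMl.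
apply: lt_le_trans z1 _; apply: le_trans (Re_le_normc _).
case: (t) rt => a b /= a0; rewrite mul0r subr0 lerBrDr gerDl.
by rewrite mulr_ge0_le0.
Qed.

(** The straight segment from 0 to t may come within [nc z] of the point 1, hence the detour through
    i Im t: |1 - s| >= 1 on the vertical leg, and |1 - s| > |1 - t| on the horizontal one, which
    stops at distance e from t. *)
Lemma gen_eq_right : 0 < complex.Re t -> nc z <= nc (1 - t) ->
  forall e : R, 0 < e <= complex.Re t -> gen_sum g z (t - e%:C) = G (t - e%:C).
Proof.
move=> rt zt e /andP[e0 et]; apply: zero_near_eq.
have rt1 : complex.Re t < 1 by apply: le_lt_trans (Re_le_normc t) t1.
pose b := 0 +i* complex.Im t; pose v := complex.Re t - e.
have -> : t - e%:C = b + v%:C.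
  by rewrite /b /v; case: (t) => x y /=; apply/eqP; rewrite eq_complex /=;
    apply/andP; split; apply/eqP; ring.
apply: gen_zero_segment.
  move=> x /andP[x0 x1]; rewrite -rmorphM.
  have xv : 0 <= x * v <= v by rewrite mulr_ge0 ?ler_piMl// /v; lra.
  move: xv; move: (x * v) => y /andP[y0 yv]; rewrite /v in yv.
  split.
    apply: normc_lt_sqr; rewrite /b /= addr0 add0r ltrD2r.
    by rewrite ltr_pXn2r ?nnegrE//; lra.
  apply: le_lt_trans zt _; apply: normc_lt_sqr; rewrite /b.
  case: (t) rt rt1 et yv => c f /= *; rewrite ?(add0r, addr0, sub0r) ltrD2r.
  by rewrite ltr_pXn2r ?nnegrE//; lra.
have := @gen_zero_segment 0 b; rewrite add0r; apply; last exact: gen_zero_near0.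
move=> x /andP[x0 x1]; rewrite add0r /b.
have -> : x%:C * (0 +i* complex.Im t) = 0 +i* (x * complex.Im t).
  by apply/eqP; rewrite eq_complex /=; apply/andP; split; apply/eqP; ring.
split.
  apply: normc_lt_sqr; rewrite /= expr0n /= add0r exprMn.
  rewrite ltr_pwDl ?exprn_gt0//.
  by rewrite ler_piMl ?sqr_ge0// exprn_ile1.
apply: lt_le_trans z1 _; apply: le_trans (Re_le_normc _).
by rewrite /= subr0.
Qed.

(** Here |1 - t| >= 1 > |z|, so F is continuous at t, and Abel's theorem is applied along the
    radius, with Stolz constant 1. *)
Lemma gen_limit_left : complex.Re t <= 0 -> S = gen_sum g z t.
Proof.
move=> rt; apply: eq_normc_small => e e0; have e2 : 0 < e / 2 by rewrite divr_gt0.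
have [d0 d00 Ab] := abel_stolz 1 St e2.
have zt : nc z < nc (1 - t).
  apply: lt_le_trans z1 _; apply: le_trans (Re_le_normc _).
  by case: (t) rt => a b /= a0; rewrite lerBrDr gerDl.
have [C [rho [r0 lip]]] := gen_sum_lipschitz g t1 zt.
have C1 : 0 < `|C| + 1 by rewrite ltr_wpDl.
have a0 : 0 < Num.min 1 d0 by rewrite lt_min ltr01.
have [eta [p0 pm pr pe]] := exists_pos_lt a0 r0 (divr_gt0 e2 C1).
move: pm; rewrite lt_min => /andP[p1 pd].
have nx : nc (1 - eta)%:C = 1 - eta by rewrite normc_real ger0_norm//; lra.
have n1x : nc (1 - (1 - eta)%:C) = eta.
  by rewrite -(rmorph1 (real_complex R)) -rmorphB normc_real opprB addrC subrK gtr0_norm.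
have xt : nc ((1 - eta)%:C * t) < nc t.
  by rewrite Normc.normcM nx gtr_pMl//; lra.
have GS : nc (G ((1 - eta)%:C * t) - S) < e / 2.
  apply: (Ab (1 - eta)%:C); rewrite ?nx ?n1x; try lra.
  by apply: eq_csum (GP xt) => n; rewrite exprMn; ring.
have FG := gen_eq_left rt (x := 1 - eta).
have hE : (1 - eta)%:C * t = t + - (eta%:C * t) by rewrite rmorphB rmorph1 /=; ring.
have nh : nc (- (eta%:C * t)) <= eta.
  by rewrite normc_opp Normc.normcM normc_real gtr0_norm// ler_piMr// ltW.
have := lip _ (le_lt_trans nh pr); rewrite -hE FG; last by apply/andP; split; lra.
move=> L; have T := normc_triangle S (G ((1 - eta)%:C * t)) (gen_sum g z t).
rewrite (normc_distC S (G _)) in T.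
have CC : C <= `|C| + 1 by have := ler_norm C; lra.
have L2 : C * nc (- (eta%:C * t)) <= e / 2.
  apply: le_trans (ler_wpM2r (normc_ge0 _) CC) _.
  apply: le_trans (ler_wpM2l (ltW C1) nh) _.
  by move: pe; rewrite ltr_pdivlMr// mulrC => /ltW.
by lra.
Qed.

(** When |z| = |1 - t|, F need not be analytic at t. Along t - eta Abel's theorem is applied twice,
    to G at t and to [lerch g] at z / (1 - t), while the power factor is continuous. *)
Lemma gen_limit_right : 0 < complex.Re t -> nc z <= nc (1 - t) ->
  csum (fun k => lerch_coef g k * (z / (1 - t)) ^+ k) (lerch g (z / (1 - t))) ->
  S = gen_sum g z t.
Proof.
move=> rt zt Wt; have nz := one_sub_neq0 t1.
have nw : nc (z / (1 - t)) <= 1.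
  by rewrite Normc.normcM Normc.normcV ler_pdivrMr ?normc_gt0// mul1r.
set w0 := z / (1 - t) in Wt nw *.
set A := Cpow (1 - t) (- g); set B := lerch g w0.
have ry : 0 < complex.Re (1 - t) by exact: Re_one_sub_gt0.
apply: eq_normc_small => e e0; have := normc_ge0 A; have := normc_ge0 B => B0 A0.
(* Gathers the errors: e1 from G, and (|A| + 1) e1 + e1 |B| from the product. *)
pose K := nc A + nc B + 2; have K0 : 0 < K by rewrite /K; lra.
pose e1 := Num.min 1 (e / K).
have e10 : 0 < e1 by rewrite lt_min ltr01 divr_gt0.
have e11 : e1 <= 1 by rewrite ge_min lexx.
have e1K : e1 * K <= e by rewrite -ler_pdivlMr// ge_min lexx orbT.
have [d1 d10 Ab1] := abel_stolz (2 * nc t / complex.Re t) St e10.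
have [d2 d20 Ab2] := abel_stolz (2 * (nc (1 - t) + 1) / complex.Re (1 - t)) Wt e10.
have [C [rho [r0 lip]]] := Cpow_one_sub_lipschitz g t1.
have C1 : 0 < `|C| + 1 by rewrite ltr_wpDl.
have a0 : 0 < Num.min 1 (complex.Re t) by rewrite lt_min ltr01.
(* [stolz_left] bounds [nc (1 - x)] by [eta / p], hence the factors Re t and Re (1 - t). *)
have b0 : 0 < Num.min (d1 * complex.Re t) (d2 * complex.Re (1 - t)).
  by rewrite lt_min !mulr_gt0.
have c0 : 0 < Num.min rho (e1 / (`|C| + 1)) by rewrite lt_min r0 divr_gt0.
have [eta [p0]] := exists_pos_lt a0 b0 c0.
rewrite !lt_min => /andP[p1 pt] /andP[pd1 pd2] /andP[pr pe].
have FG := gen_eq_right rt zt (e := eta).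
have {}FG : gen_sum g z (t - eta%:C) = G (t - eta%:C) by apply: FG; rewrite p0 ltW.
set tau := t - eta%:C in FG.
have hA : nc (Cpow (1 - tau) (- g) - A) < e1.
  have nh : nc (- eta%:C) = eta by rewrite normc_opp normc_real gtr0_norm.
  have := lip (- eta%:C); rewrite nh => /(_ pr) /le_lt_trans; apply.
  apply: le_lt_trans (_ : (`|C| + 1) * eta < _).
    by rewrite ler_pM2r//; have := ler_norm C; lra.
  by rewrite mulrC -ltr_pdivlMr.
have hG : nc (G tau - S) < e1.
  have [|x1 x2 x3 x4] := stolz_left rt (lexx _) (lexx _) (eta := eta); first by rewrite p0 ltW.
  apply: (Ab1 _ x1 x2); first by apply: le_lt_trans x3 _; rewrite ltr_pdivrMr.
  have xt : nc tau < nc t by rewrite /tau -x4 Normc.normcM gtr_pMl.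
  by apply: eq_csum (GP xt) => n; rewrite /tau -x4 exprMn; ring.
have hB : nc (lerch g (z / (1 - tau)) - B) < e1.
  have yE : complex.Re (1 - tau) = complex.Re (1 - t) + eta.
    by rewrite /tau; case: (t) => a b /=; ring.
  (* The base point 1 - tau moves with eta, so the Stolz constant rests on bounds uniform in eta <
     1. *)
  have yQ : nc (1 - tau) <= nc (1 - t) + 1.
    rewrite /tau opprB addrCA addrC; apply: le_trans (normcD _ _) _.
    by rewrite lerD2l normc_real gtr0_norm// ltW.
  have [||x1 x2 x3 x4] := stolz_left ry (y := 1 - tau) _ yQ (eta := eta).
  - by rewrite yE lerDl ltW.
  - by rewrite yE p0 lerDr ltW.
  set x := 1 - eta%:C / (1 - tau) in x1 x2 x3 x4.
  (* Moving left by eta from 1 - tau leads back to 1 - t, so x = (1 - t) / (1 - tau) and z / (1 -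
     tau) = w0 x. *)
  have x4' : x * (1 - tau) = 1 - t by rewrite x4 /tau; ring.
  have ntau : 1 - tau != 0.
    by apply: contra nz => /eqP h; rewrite -x4' h mulr0.
  have xn : x != 0 by apply: contra nz => /eqP h; rewrite -x4' h mul0r.
  have wE : z / (1 - tau) = w0 * x.
    by rewrite /w0 -x4' ; field; rewrite xn ntau.
  have w1 : nc (z / (1 - tau)) < 1.
    rewrite wE Normc.normcM; apply: le_lt_trans x1; rewrite ler_piMl ?normc_ge0//.
  apply: (Ab2 _ x1 x2); first by apply: le_lt_trans x3 _; rewrite ltr_pdivrMr.
  by apply: eq_csum (lerch_csum (g := g) w1) => k; rewrite wE exprMn; ring.
have t0' := normc_triangle S (G tau) (A * B).
rewrite (normc_distC S (G tau)) in t0'; apply: le_trans t0' _.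
rewrite -FG /gen_sum; set A' := Cpow (1 - tau) (- g) in hA *.
set B' := lerch g (z / (1 - tau)) in hB *.
have prod := mul_normc_close e11 hA hB.
apply: le_trans e1K; rewrite /K.
have -> : e1 * (nc A + nc B + 2) = e1 + ((nc A + 1) * e1 + e1 * nc B) by ring.
by rewrite lerD//; apply: ltW; move: hG; rewrite -FG /gen_sum.
Qed.

End Continuation.

End GeneratingFunction.

(** * Specialisation to the extended Hurwitz-Lerch function *)

Section HurwitzLerch.
Variable R : realType.
Implicit Types (g th up z sg a t : R[i]).

(** The factor of [HLZ_term] free of g and z, hence common to all the shifted parameters g + n. *)
Definition HLZ_coef th up sg a (p lam : R) (k : nat) : R[i] :=
  extBeta (th + k%:R) (up - th) p lam / Beta th (up - th) / Cpow (k%:R + a) sg.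

Lemma HLZ_coef_subexponential th up sg a (p lam : R) :
  (forall m : nat, a != - m%:R) -> subexponential (HLZ_coef th up sg a p lam).
Proof.
move=> ha rho rho01; have [M HM] := extBeta_bounded th (up - th) p lam.
have [D HD] := subexponential_CpowV sg ha rho01.
exists (M * nc (Beta th (up - th))^-1 * D) => k.
have /andP[rho0 _] := rho01.
rewrite /HLZ_coef Normc.normcM [nc (extBeta _ _ _ _ * _)]Normc.normcM -[leLHS]mulrA.
apply: ler_pM => //; rewrite ?mulr_ge0 ?normc_ge0 ?exprn_ge0 ?(ltW rho0)//.
by rewrite ler_wpM2r ?normc_ge0.
Qed.

Lemma HLZ_termE g th up z sg a (p lam : R) k : HLZ_term g th up z sg a p lam k =
  lerch_coef (HLZ_coef th up sg a p lam) g k * z ^+ k.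
Proof. by rewrite /HLZ_term /lerch_coef /bcoef /HLZ_coef invfM; ring. Qed.

Lemma HLZE g th up z sg a (p lam : R) :
  HLZ g th up z sg a p lam = lerch (HLZ_coef th up sg a p lam) g z.
Proof.
rewrite /HLZ /lerch (_ : HLZ_term g th up z sg a p lam = fun k =>
  lerch_coef (HLZ_coef th up sg a p lam) g k * z ^+ k)//.
by apply/funext => k; exact: HLZ_termE.
Qed.

Lemma genHLZ_termE g th up z sg a (p lam : R) t n :
  genHLZ_term g th up z sg a p lam t n =
  gen_coef (HLZ_coef th up sg a p lam) g z n * t ^+ n.
Proof. by rewrite /genHLZ_term HLZE /gen_coef /bcoef; ring. Qed.

(** For large n the real part in the boundary alternative falls below 1, which leaves only |z| <
    1. *)
Lemma HLZ_dom_shift_lt1 g th up z sg :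
  (forall n : nat, HLZ_dom (g + n%:R) th up z sg) -> nc z < 1.
Proof.
move=> hz; have [n hn] := exists_nat_ge (complex.Re (sg + up - g - th)).
have [|[_]] := hz n.+1; first by rewrite normcC ltcR.
have -> : sg + up - (g + n.+1%:R) - th = sg + up - g - th - n.+1%:R by ring.
rewrite raddfB /= -(rmorph_nat (real_complex R)) /= => h.
by move: h hn; lra.
Qed.

End HurwitzLerch.

Unset Implicit Arguments.
Set Strict Implicit.

(** At t = 1 - z the argument z / (1 - t) reaches 1, in general a singularity, so |t| < 1 does not
    ensure convergence on the left. The first clause proves it when |z| + |t| < 1; the second
    assumes it and equates the sums. *)
Theorem theorem4p2 (R : realType) (p lam : R) (g th up z sg a t : R[i])
    (hp : 0 <= p) (hlam : 0 < lam)
    (ha : forall m : nat, a != - m%:R)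
    (ht : `|t| < 1)
    (hz : forall n : nat, HLZ_dom (g + n%:R) th up z sg) :
  (`|z| + `|t| < 1 ->
     series (genHLZ_term g th up z sg a p lam t) @ \oo -->
       (Cpow (1 - t) (- g) * HLZ g th up (z / (1 - t)) sg a p lam : R[i]^o)) /\
  (HLZ_dom g th up (z / (1 - t)) sg ->
   (`|z / (1 - t)| = 1 -> cvgn (series (HLZ_term g th up (z / (1 - t)) sg a p lam))) ->
   cvgn (series (genHLZ_term g th up z sg a p lam t)) ->
     limn (series (genHLZ_term g th up z sg a p lam t)) =
       Cpow (1 - t) (- g) * HLZ g th up (z / (1 - t)) sg a p lam).
Proof.
have z1 := HLZ_dom_shift_lt1 hz.
have t1 : nc t < 1 by rewrite -ltcR -normcC.
have dsub := HLZ_coef_subexponential th up sg p lam ha.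
have termE : genHLZ_term g th up z sg a p lam t =
    fun n => gen_coef (HLZ_coef th up sg a p lam) g z n * t ^+ n.
  by apply/funext => n; exact: genHLZ_termE.
have hltermE w : HLZ_term g th up w sg a p lam =
    fun k => lerch_coef (HLZ_coef th up sg a p lam) g k * w ^+ k.
  by apply/funext => k; exact: HLZ_termE.
rewrite HLZE termE hltermE; split.
  by rewrite !normcC -rmorphD ltcR => zt; exact: (gen_series dsub (g := g) zt).
move=> dom bd cv; set S := limn _.
have SP : csum (fun n => gen_coef (HLZ_coef th up sg a p lam) g z n * t ^+ n) S by exact: cv.
change (@eq R[i] S (gen_sum (HLZ_coef th up sg a p lam) g z t)).
(* The disc of radius [nc t] is empty at t = 0, where the absolutely convergent identity applies. *)
have [t0|t0] := eqVneq t 0.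
  have zt : nc z + nc t < 1 by rewrite t0 Normc.normc0 addr0.
  exact: csum_uniq SP (gen_series dsub (g := g) zt).
have [rt|rt] := leP (complex.Re t) 0.
  exact: (gen_limit_left dsub z1 t1 t0 SP rt).
have n0 : 0 < nc (1 - t) by rewrite normc_gt0 one_sub_neq0.
(* Convergence at z / (1 - t) is automatic inside the unit disc and comes from [bd] on the
   circle. *)
have [wle Wt] : nc (z / (1 - t)) <= 1 /\
    csum (fun k => lerch_coef (HLZ_coef th up sg a p lam) g k * (z / (1 - t)) ^+ k)
      (lerch (HLZ_coef th up sg a p lam) g (z / (1 - t))).
  case: dom => [|[w1 _]].
    rewrite normcC ltcR => w1; split; first exact: ltW.
    exact: lerch_csum.
  split; last exact: bd.
  by rewrite -lecR -normcC w1.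
apply: (gen_limit_right dsub z1 t1 t0 SP rt _ Wt).
by move: wle; rewrite Normc.normcM Normc.normcV ler_pdivrMr// mul1r.
Qed.
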